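(* Under the standing setup, the component $X^1$ of $X$ is a Markov chain with respect to its own filtration $\mathbb F^{X^1}$ if and only if there exist locally integrable functions $\lambda^1_{x^1y^1}$, $x^1\neq y^1\in\mathcal X^1$, such that for all $x^1,y^1\in\mathcal X^1$ with $x^1\neq y^1$, $$\mathbb 1_{\{X^1_t=x^1\}}\sum_{x^2,y^2\in\mathcal X^2}\lambda^{x^1x^2}_{y^1y^2}(t)\,\mathbb E_{\mathbb P}\big(\mathbb 1_{\{X^2_t=x^2\}}\,\big|\,\mathcal F^{X^1}_t\big)=\mathbb 1_{\{X^1_t=x^1\}}\lambda^1_{x^1y^1}(t)\qquad dt\otimes d\mathbb P\text{-a.e.}$$ In that case the generator of $X^1$ is $\Lambda^1(t)=[\lambda^1_{x^1y^1}(t)]_{x^1,y^1\in\mathcal X^1}$ with $\lambda^1_{x^1x^1}(t)=-\sum_{y^1\neq x^1}\lambda^1_{x^1y^1}(t)$.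
   Context: Standing setup: $(\Omega,\mathcal F,\mathbb P)$ is a probability space; $\mathcal X^n\subset\mathbb R$, $n=1,2$, are finite sets and $\mathcal X=\mathcal X^1\times\mathcal X^2$. $X=(X^1,X^2)$ is a càdlàg process with values in $\mathcal X$ which is a Markov chain in its natural filtration $\mathbb F^X$, with infinitesimal generator $\Lambda(t)=[\lambda^{x^1x^2}_{y^1y^2}(t)]$, whose entries are locally integrable deterministic functions, nonnegative off the diagonal, with rows summing to $0$. $\mathbb F^{X^i}$ denotes the natural filtration of $X^i$. *)

(* Defs.v *)
From HB Require Import structures.
From mathcomp Require Import all_boot all_order all_algebra.
From mathcomp Require Import all_classical all_reals all_analysis.
Set Implicit Arguments. Unset Strict Implicit. Unset Printing Implicit Defensive.
Import Order.TTheory GRing.Theory Num.Theory.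
Import numFieldNormedType.Exports.
Local Open Scope classical_set_scope.
Local Open Scope ring_scope.

Section Defs.
Context {d : measure_display} {Omega : measurableType d} {R : realType}.
Variable P : probability Omega R.

Definition cond_exp_version (G : set (set Omega)) (f Y : Omega -> R) : Prop :=
  [/\ (forall B : set R, measurable B -> G (Y @^-1` B)),
      P.-integrable setT (EFin \o Y) &
      forall A, G A -> (\int[P]_(w in A) (Y w)%:E = \int[P]_(w in A) (f w)%:E)%E].

Definition natural_filtration (S : Type) (Y : R -> Omega -> S) (t : R)
  : set (set Omega) :=
  <<s [set A | exists s a, 0 <= s <= t /\ A = Y s @^-1` [set a]] >>.

Definition martingale (F : R -> set (set Omega)) (M : R -> Omega -> R) : Prop :=
  forall s t, 0 <= s -> s <= t -> cond_exp_version (F s) (M t) (M s).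

(* Markov property of Y w.r.t. the filtration F: Y adapted, and
   E(1_{Y_t = y} | F_s) is sigma(Y_s)-measurable, i.e. of the form g(Y_s). *)
Definition markov_wrt (S : finType) (F : R -> set (set Omega))
  (Y : R -> Omega -> S) : Prop :=
  (forall t, 0 <= t -> forall a, F t (Y t @^-1` [set a])) /\
  (forall s t, 0 <= s -> s <= t -> forall y : S, exists g : S -> R,
     cond_exp_version (F s) (\1_(Y t @^-1` [set y])) (fun w => g (Y s w))).

(* L is the generator of Y w.r.t. F (martingale characterization):
   1_{Y_t = y} - int_0^t L(u)_{Y_u, y} du is an F-martingale for each y. *)
Definition has_generator (S : finType) (F : R -> set (set Omega))
  (Y : R -> Omega -> S) (L : R -> S -> S -> R) : Prop :=
  forall y : S, martingale F (fun t w =>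
    \1_(Y t @^-1` [set y]) w
    - Rintegral lebesgue_measure `[0, t]%classic (fun u => L u (Y u w) y)).

Definition markov_chain_with_generator (S : finType) (F : R -> set (set Omega))
  (Y : R -> Omega -> S) (L : R -> S -> S -> R) : Prop :=
  markov_wrt F Y /\ has_generator F Y L.
End Defs.

Section Defs2.
Context {R : realType}.

Definition locally_integrable (f : R -> R) : Prop :=
  forall T : R, 0 <= T ->
    lebesgue_measure.-integrable `[0, T]%classic (EFin \o f).

Definition is_generator_fun (S : finType) (L : R -> S -> S -> R) : Prop :=
  [/\ forall x y, locally_integrable (fun t => L t x y),
      forall t x y, 0 <= t -> x != y -> 0 <= L t x y &
      forall t x, 0 <= t -> \sum_(y : S) L t x y = 0].

(* cadlag path with values in a finite subset of R (discrete topology):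
   right-constant at every t >= 0, and with a left limit at every t > 0 *)
Definition cadlag_fin (S : Type) (f : R -> S) : Prop :=
  forall t, 0 <= t ->
    (exists2 e, 0 < e & forall u, t <= u < t + e -> f u = f t) /\
    (0 < t -> exists2 e, 0 < e & exists a, forall u, t - e < u < t -> f u = a).

Definition diag_complete (S : finType) (L : R -> S -> S -> R) : R -> S -> S -> R :=
  fun t x y => if x == y then - \sum_(z : S | z != x) L t x z else L t x y.
End Defs2.

Definition pair_process {R : Type} {Omega S1 S2 : Type}
  (X1 : R -> Omega -> S1) (X2 : R -> Omega -> S2) : R -> Omega -> S1 * S2 :=
  fun t w => (X1 t w, X2 t w).

Section Defs3.
Context {d : measure_display} {Omega : measurableType d} {R : realType}.
Variable P : probability Omega R.

(* The condition of the theorem: for all x1 <> y1, dt (x) dP-a.e. (read as: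
   for a.e. t >= 0, P-a.s.), for any choice of versions Y t x2 of
   E_P(1_{X^2_t = x^2} | F^{X^1}_t),
   1_{X^1_t=x1} sum_{x2,y2} lambda^{x1x2}_{y1y2}(t) Y t x2 = 1_{X^1_t=x1} L1 t x1 y1 *)
Definition consistency_condition (S1 S2 : finType)
  (X1 : R -> Omega -> S1) (X2 : R -> Omega -> S2)
  (Lam : R -> S1 * S2 -> S1 * S2 -> R) (L1 : R -> S1 -> S1 -> R) : Prop :=
  (forall x1 y1, x1 != y1 -> locally_integrable (fun t => L1 t x1 y1)) /\
  forall x1 y1 : S1, x1 != y1 ->
  forall Y : R -> S2 -> Omega -> R,
    (forall t x2, 0 <= t ->
       cond_exp_version P (natural_filtration X1 t)
         (\1_(X2 t @^-1` [set x2])) (Y t x2)) ->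
    {ae lebesgue_measure, forall t : R, 0 <= t ->
      {ae P, forall w : Omega,
        \1_(X1 t @^-1` [set x1]) w *
          (\sum_(x2 : S2) \sum_(y2 : S2) Lam t (x1, x2) (y1, y2) * Y t x2 w)
        = \1_(X1 t @^-1` [set x1]) w * L1 t x1 y1}}.
End Defs3.

(* Main.v *)
Require Import Defs.
From HB Require Import structures.
From mathcomp Require Import all_boot all_order all_algebra.
From mathcomp Require Import all_classical all_reals all_analysis.
From mathcomp Require Import measurable_realfun ring lra.
(* Integrating the martingales of a chain Z over an event A of the past turns
   "L is the generator of Z" into a linear integral equation, the forward
   equation, for the functions u |-> P(A, Z_u = x).

   Sufficiency: the forward equation of X, summed over the second coordinate,
   becomes under the consistency condition the forward equation of X^1 with
   rates L1.  This equation has a unique solution (Gronwall), so P(A, X^1_t = y)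
   is the mixture of the P(X^1_s = x, X^1_t = y) with weights P(A | X^1_s = x),
   which is the Markov property.

   Necessity: take L1(t)_{xy} = E(rate of X^1 from x to y at t | X^1_t = x).
   The Markov property makes P(B, X^1_s = x, X^1_t = y) proportional to
   P(X^1_s = x, X^1_t = y) for B in the past of s; dividing by t - s and letting
   t decrease to s (Lebesgue differentiation) gives, for almost every s, the
   same proportionality for E(1_B 1_{X^1_s = x} rate).  The null set of times
   depends on B, so B first ranges over countably many rational cylinders, and
   the pi-lambda theorem extends the identity to the whole past of s. *)

Set Implicit Arguments. Unset Strict Implicit. Unset Printing Implicit Defensive.
Import Order.TTheory GRing.Theory Num.Theory.
Import numFieldNormedType.Exports.
Local Open Scope classical_set_scope.
Local Open Scope ring_scope.

(** * Right-constant processes and occupation integrals *)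

(* Z is the limit of Z at the grid points that follow u, capped at tm: only the
   times in [0, tm] are used, so T may carry the sigma-algebra of the past of tm. *)
Lemma right_constant_measurable (R : realType) d' (T : measurableType d') (S : Type)
    (Z : R -> T -> S) (tm : R) :
  (forall w t, 0 <= t < tm ->
     exists2 e, 0 < e & forall u, t <= u < t + e -> Z u w = Z t w) ->
  (forall u a, 0 <= u <= tm -> measurable (Z u @^-1` [set a])) ->
  forall a, measurable [set p : R * T | `[0, tm]%classic p.1 /\ Z p.1 p.2 = a].
Proof.
move=> rc mZ a.
pose phi (n k : nat) := Num.min (k.+1%:R / n.+1%:R) tm : R.
pose C n (k : nat) := (`[0, tm] `&` `[k%:R / n.+1%:R, k.+1%:R / n.+1%:R[)%classic : set R.
pose B n := \bigcup_k (C n k `*` Z (phi n k) @^-1` [set a]).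
have mB n : measurable (B n).
  apply: bigcup_measurable => k _.
  have [tm0|tm0] := ltP tm 0.
    rewrite /C set_itv_ge ?set0I ?set0X//.
    by rewrite bnd_simp -ltNge.
  apply: measurableX.
    by apply: measurableI => //; exact: measurable_itv.
  apply: mZ; rewrite /phi le_min ge_min lexx orbT andbT tm0 andbT.
  by rewrite divr_ge0.
have BE n u w : 0 <= u <= tm ->
    B n (u, w) <-> Z (phi n (Num.truncn (u * n.+1%:R))) w = a.
  move=> utm; have un0 : 0 <= u * n.+1%:R by rewrite mulr_ge0//; case/andP: utm.
  have /andP[h1 h2] := truncn_itv un0; split.
    move=> [k _ [[_ /=]]]; rewrite in_itv/= => /andP[k1 k2] <-.
    congr (Z (phi n _) w); apply/truncn_def => //.
    by rewrite -ler_pdivrMr// -ltr_pdivlMr// k1.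
  move=> Zw; exists (Num.truncn (u * n.+1%:R)) => //; split=> //=; split=> //=.
  rewrite in_itv/= ler_pdivrMr// ltr_pdivlMr//; exact/andP.
have ZE u w : 0 <= u <= tm -> exists N, forall n, (N <= n)%N ->
    Z (phi n (Num.truncn (u * n.+1%:R))) w = Z u w.
  move=> /andP[u0 utm]; have un0 n : 0 <= u * n.+1%:R by rewrite mulr_ge0.
  have uphi n : u < (Num.truncn (u * n.+1%:R)).+1%:R / n.+1%:R.
    by rewrite ltr_pdivlMr// truncnS_gt.
  have [tmu|tmu] := leP tm u.
    exists 0%N => n _; congr (Z _ w).
    have {}tmu : u = tm by apply/eqP; rewrite eq_le tmu utm.
    by rewrite /phi [RHS]tmu; apply/min_idPr; rewrite -tmu ltW.
  have [|e e0 He] := rc w u; first by rewrite u0.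
  exists (Num.truncn e^-1) => n Nn; apply: He.
  rewrite /phi le_min (ltW (uphi n)) utm/= gt_min; apply/orP; left.
  rewrite ltr_pdivrMr// -natr1 mulrDl.
  rewrite ler_ltD//; first by case/andP: (truncn_itv (un0 n)).
  rewrite mulrC -ltr_pdivrMr// div1r.
  by rewrite (lt_le_trans (truncnS_gt _))// ler_nat ltnS.
(* By [ZE] the discretized state is eventually the true one, so the set is the limit inferior of the
   [B n]. *)
rewrite (_ : [set _ | _] = \bigcup_N \bigcap_n B (N + n)%N); last first.
  apply/seteqP; split=> [[u w]/= [utm Zu]|[u w] [N _ Bw]/=].
    have utm' : 0 <= u <= tm by move: utm; rewrite /= in_itv.
    have [N HN] := ZE u w utm'.
    exists N => // n _; apply/BE => //; rewrite HN ?leq_addr//.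
  have utm : `[0, tm]%classic u by have [k _ [[]]] := Bw 0%N I.
  have utm' : 0 <= u <= tm by move: utm; rewrite /= in_itv.
  split => //; have [N' HN'] := ZE u w utm'.
  rewrite -(HN' (N + N')%N) ?leq_addl//; apply/BE => //; exact: Bw.
by apply: bigcup_measurable => N _; apply: bigcap_measurable => // n _; exact: mB.
Qed.

Section occupation.
Context (R : realType) d (T : measurableType d) (P : probability T R).
Context (S : Type) (Z : R -> T -> S) (tm : R).
Hypothesis rcZ : forall w t, 0 <= t < tm ->
  exists2 e, 0 < e & forall u, t <= u < t + e -> Z u w = Z t w.
Hypothesis mZ : forall u a, 0 <= u <= tm -> measurable (Z u @^-1` [set a]).
Variable f : R -> R.
Hypothesis intf : lebesgue_measure.-integrable `[0, tm] (EFin \o f).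

Local Notation occ a w := (\int[lebesgue_measure]_(u in `[0, tm])
  (f u * \1_(Z u @^-1` [set a]) w)).
Let G a := [set p : R * T | `[0, tm]%classic p.1 /\ Z p.1 p.2 = a].
Let g := f \_ `[0, tm].
Let mG a : measurable (G a). Proof. exact: right_constant_measurable. Qed.
Let intg : lebesgue_measure.-integrable setT (EFin \o g).
Proof. by rewrite /g -restrict_EFin -integrable_mkcond. Qed.
Let mg : measurable_fun setT g.
Proof. by apply/measurable_EFinP; exact: measurable_int intg. Qed.

(** Integrand of a double integral over time and [T]. Integrating out the time leaves the occupation
    integral on [A]; integrating out the sample point leaves [f u] times a probability. Fubini's
    theorem equates the two. *)
Let h a A (p : R * T) : \bar R := (g p.1 * (\1_(G a) p * \1_A p.2))%:E.

Let mh a A : measurable A -> measurable_fun setT (h a A).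
Proof.
move=> mA; apply/measurable_EFinP; apply: measurable_funM.
  exact: measurableT_comp.
apply: measurable_funM; first exact: measurable_indic.
by apply: measurableT_comp => //; exact: measurable_indic.
Qed.

Let inth a A : measurable A -> (lebesgue_measure \x P)%E.-integrable setT (h a A).
Proof.
move=> mA; apply/integrable12ltyP; first exact: mh.
case/integrableP : intg => _; apply: le_lt_trans.
apply: ge0_le_integral => //.
- by move=> u _; exact: integral_ge0.
- apply: (measurable_fun_fubini_tonelli_F (abse \o h a A)) => //=.
  by apply: measurableT_comp => //; exact: mh.
- by apply: measurable_int; exact: integrable_abse intg.
move=> u _; apply: (@le_trans _ _ (\int[P]_(y in setT) (cst `|g u|%:E y))%E).
  apply: ge0_le_integral => //.
  - apply: measurableT_comp => //; apply: measurableT_comp; first exact: mh.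
    exact: measurable_pair1.
  - move=> w _; rewrite /h/= lee_fin normrM ler_piMr// normrM.
    by rewrite !indicE; do 2 case: (_ \in _); rewrite ?(normr1,normr0,mulr1,mul0r,ler01,lexx).
by rewrite integral_cst// [X in (_ * X)%E]probability_setT mule1.
Qed.

Let hE a A u : measurable A ->
  (\int[P]_w h a A (u, w) =
    (g u * fine (P (A `&` Z u @^-1` [set a])))%:E)%E.
Proof.
move=> mA; rewrite /h/=.
have [utm|utm] := pselect (`[0, tm]%classic u); last first.
  rewrite /g patchE memNset//.
  by under eq_integral do rewrite mul0r; rewrite integral0 mul0r.
have mZu : measurable (Z u @^-1` [set a]) by apply: mZ; move: utm; rewrite /= in_itv.
rewrite (eq_integral (fun w => ((g u)%:E * (\1_(A `&` Z u @^-1` [set a]) w)%:E)%E)).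
  rewrite integralZl//; last first.
    by apply: integrable_indic; exact: measurableI.
  rewrite integral_indic//; last exact: measurableI.
  by rewrite setIT EFinM fineK// fin_num_measure//; exact: measurableI.
move=> w _; rewrite -EFinM mulrC indicI/= !indicE mulrC; congr (_ * _)%:E.
rewrite mulrC; congr (_ * _%:R); apply: congr1.
apply/idP/idP => /set_mem/=; last by move=> ?; exact/mem_set.
by case=> _ ?; exact/mem_set.
Qed.

Let gE a w u : g u * \1_(G a) (u, w) = ((fun u => f u * \1_(Z u @^-1` [set a]) w) \_ `[0, tm]) u.
Proof.
rewrite /g !patchE; case: ifPn => utm; last by rewrite mul0r.
congr (_ * _); rewrite !indicE; congr (_ %:R); apply: congr1.
apply/idP/idP => /set_mem/=; first by move=> [_ ?]; exact/mem_set.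
by move=> ?; apply/mem_set; split => //; exact: set_mem.
Qed.

Lemma path_integrable a w :
  lebesgue_measure.-integrable `[0, tm]
    (EFin \o (fun u => f u * \1_(Z u @^-1` [set a]) w)).
Proof.
apply/(integrable_mkcond _ _).2 => //; rewrite restrict_EFin.
have -> : EFin \o (fun u => f u * \1_(Z u @^-1` [set a]) w) \_ `[0, tm] =
    ((EFin \o (fun u : R => \1_(G a) (u, w) : R)) \* (EFin \o g))%E.
  by apply/funext => u; rewrite /= -gE mulrC EFinM.
apply: integrableMr => //.
- apply: (measurableT_comp (measurable_indic (mG a))); exact: measurable_pair2.
- exists 1; split=> // M M1 u _ /=; rewrite (le_trans _ (ltW M1))// indicE.
  by case: (_ \in _); rewrite ?(normr1,normr0).
Qed.

Let occE a A w : (\int[lebesgue_measure]_u h a A (u, w) =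
  (occ a w * \1_A w)%:E)%E.
Proof.
transitivity (\int[lebesgue_measure]_u
    ((((fun u => f u * \1_(Z u @^-1` [set a]) w) \_ `[0, tm]) u)%:E * (\1_A w)%:E))%E.
  by apply: eq_integral => u _; rewrite -gE -EFinM /h/= mulrA.
have := path_integrable a w => /(integrable_mkcond _ _).1.
rewrite restrict_EFin => /(_ (measurable_itv _)) ig.
rewrite integralZr//.
rewrite EFinM Rintegral_mkcond /Rintegral fineK//.
exact: integrable_fin_num.
Qed.


Lemma occupation_le a w : `|occ a w| <= \int[lebesgue_measure]_(u in `[0, tm]) `|f u|.
Proof.
apply: le_trans; first by apply: le_normr_Rintegral => //; exact: path_integrable.
apply: le_Rintegral => //.
- exact/integrable_norm/path_integrable.
- exact/integrable_norm.
move=> u _; rewrite normrM indicE ler_piMr//; by case: (_ \in _); rewrite ?(normr1,normr0).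
Qed.

Lemma occupation_measurable a : measurable_fun setT (fun w => occ a w).
Proof.
apply/measurable_EFinP.
apply: eq_measurable_fun (measurable_fubini_G (inth a measurableT)) => w _.
by rewrite /fubini_G/= occE// indicT mulr1.
Qed.

Lemma occupation_integrable a : P.-integrable setT (EFin \o (fun w => occ a w)).
Proof.
apply: measurable_bounded_integrable => //.
- exact: (le_lt_trans (probability_le1 P measurableT)) (ltry 1).
- exact: occupation_measurable.
- exists (\int[lebesgue_measure]_(u in `[0, tm]) `|f u|); split => [|M]; first exact: num_real.
  by move=> fM w _; exact: le_trans (occupation_le _ _) (ltW fM).
Qed.

(** A partial integral of [h]: Fubini's theorem supplies measurability in [u] together with
    integrability. *)
Lemma occupation_prob_integrable a A : measurable A ->
  lebesgue_measure.-integrable `[0, tm]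
    (EFin \o (fun u => f u * fine (P (A `&` Z u @^-1` [set a])))).
Proof.
move=> mA; apply/(integrable_mkcond _ _).2 => //; rewrite restrict_EFin.
apply: eq_integrable (integrable_fubini_F (inth a mA)) => //.
move=> u _; rewrite /fubini_F hE// /= !patchE /g patchE; case: ifP => // _.
by rewrite mul0r.
Qed.

Lemma integral_occupation a A : measurable A ->
  (\int[P]_(w in A) (occ a w)%:E)%E =
  (\int[lebesgue_measure]_(u in `[0, tm])
    (f u * fine (P (A `&` Z u @^-1` [set a]))))%:E.
Proof.
move=> mA; have := Fubini (inth a mA).
under eq_integral => u _ do rewrite hE//.
under [in X in _ = X -> _]eq_integral => w _ do rewrite occE//.
move=> E; rewrite integral_mkcond.
transitivity (\int[P]_w (occ a w * \1_A w)%:E)%E.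
  apply: eq_integral => w _; rewrite patchE indicE.
  by case: ifPn; rewrite ?mulr1 ?mulr0.
rewrite -E /Rintegral fineK; last first.
  by apply: integrable_fin_num => //; exact: occupation_prob_integrable.
rewrite [RHS]integral_mkcond; apply: eq_integral => u _.
by rewrite /g !patchE; case: ifPn => // _; rewrite mul0r.
Qed.

End occupation.

Lemma Rintegral_sum (R : realType) d (T : measurableType d)
    (mu : {measure set T -> \bar R}) (D : set T) (I : finType) (f : I -> T -> R) :
  measurable D -> (forall i, mu.-integrable D (EFin \o f i)) ->
  \int[mu]_(x in D) (\sum_i f i x) = \sum_i \int[mu]_(x in D) f i x.
Proof.
move=> mD intf; rewrite /Rintegral.
under eq_integral => x _ do rewrite -sumEFin.
rewrite integral_sum//.
have -> : (\sum_i \int[mu]_(x in D) (f i x)%:E =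
    (\sum_i fine (\int[mu]_(x in D) (f i x)%:E))%:E)%E.
  rewrite -sumEFin; apply: eq_bigr => i _; rewrite fineK//.
  by refine (integrable_fin_num mD (intf i)).
by [].
Qed.

Lemma integrable_sumR (R : realType) d (T : measurableType d)
    (mu : {measure set T -> \bar R}) (D : set T) (I : finType) (P : pred I) (f : I -> T -> R) :
  measurable D -> (forall i, P i -> mu.-integrable D (EFin \o f i)) ->
  mu.-integrable D (EFin \o (fun x => \sum_(i | P i) f i x)).
Proof.
move=> mD intf.
rewrite (_ : EFin \o _ = (fun x => \sum_(i | P i) (f i x)%:E)%E); last first.
  by apply/funext => x/=; rewrite sumEFin.
exact: integrable_sum.
Qed.

Lemma integrableZlR (R : realType) d (T : measurableType d)
    (mu : {measure set T -> \bar R}) (D : set T) (k : R) (f : T -> R) :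
  measurable D -> mu.-integrable D (EFin \o f) ->
  mu.-integrable D (EFin \o (fun x => k * f x)).
Proof. by move=> mD /(integrableZl mD k). Qed.

Lemma Rintegral_itvcc_split (R : realType) (f : R -> R) (r s t : R) :
  r <= s <= t -> lebesgue_measure.-integrable `[r, t] (EFin \o f) ->
  \int[lebesgue_measure]_(u in `[r, t]) f u =
  \int[lebesgue_measure]_(u in `[r, s]) f u +
  \int[lebesgue_measure]_(u in `[s, t]) f u.
Proof.
move=> /andP[s0 st] intf; apply/eqP; rewrite addrC -subr_eq; apply/eqP.
rewrite Rintegral_itvB// Rintegral_itv_obnd_cbnd//.
apply: integrableS intf => //; apply: subset_itvr; rewrite bnd_simp.
exact: s0.
Qed.

Lemma sum_indic_eq (R : realType) (S : finType) (T : Type) (z : T -> S) (g : S -> R) w :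
  g (z w) = \sum_x g x * \1_(z @^-1` [set x]) w.
Proof.
rewrite (bigD1 (z w))//= indicE mem_set// mulr1 big1 ?addr0// => x xz.
rewrite indicE memNset ?mulr0//= => zx; by rewrite zx eqxx in xz.
Qed.

(** * Integrals of the generator martingales over events *)

Section forward.
Context (R : realType) d (T : measurableType d) (P : probability T R).
Context (S : finType) (Z : R -> T -> S) (L : R -> S -> S -> R).
Hypothesis rcZ : forall w t, 0 <= t ->
  exists2 e, 0 < e & forall u, t <= u < t + e -> Z u w = Z t w.
Hypothesis mZ : forall u a, measurable (Z u @^-1` [set a]).
Hypothesis intL : forall x y, Defs.locally_integrable (fun t => L t x y).

Local Notation M y t w := (\1_(Z t @^-1` [set y]) w
    - \int[lebesgue_measure]_(u in `[0, t]) L u (Z u w) y).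

(** Splitting by the state occupied at time [u] makes the compensator a finite sum of occupation
    integrals, each with a deterministic rate. *)
Lemma generator_integralE t y w : 0 <= t ->
  \int[lebesgue_measure]_(u in `[0, t]) L u (Z u w) y =
  \sum_x \int[lebesgue_measure]_(u in `[0, t]) (L u x y * \1_(Z u @^-1` [set x]) w).
Proof.
move=> t0; rewrite -Rintegral_sum//; last first.
  move=> x; apply: path_integrable => //; last exact: intL.
  by move=> w' t' /andP[t'0 _]; exact: rcZ.
by apply: eq_Rintegral => u _; rewrite (sum_indic_eq (Z u) (fun x => L u x y)).
Qed.

Lemma generator_integrable t y : 0 <= t ->
  P.-integrable setT (EFin \o (fun w => M y t w)).
Proof.
move=> t0; rewrite (_ : EFin \o _ = (fun w => (\1_(Z t @^-1` [set y]) w)%:E -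
   (\sum_x \int[lebesgue_measure]_(u in `[0, t]) (L u x y * \1_(Z u @^-1` [set x]) w))%:E)%E).
  apply: integrableB => //.
    exact: integrable_indic.
  apply: integrable_sumR => // x _; apply: occupation_integrable => //; last exact: intL.
  by move=> w' t' /andP[t'0 _]; exact: rcZ.
by apply/funext => w /=; rewrite generator_integralE.
Qed.

Lemma forward_integrable t A x y : 0 <= t -> measurable A ->
  lebesgue_measure.-integrable `[0, t]
    (EFin \o (fun u => L u x y * fine (P (A `&` Z u @^-1` [set x])))).
Proof.
move=> t0 mA; apply: occupation_prob_integrable => //; last exact: intL.
by move=> w' t' /andP[t'0 _]; exact: rcZ.
Qed.

(** Fubini's theorem trades the random path for the deterministic functions [P(A, Z_u = x)]; this is
    the link between martingales and an integral equation. *)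
Lemma generator_integral_set t y A : 0 <= t -> measurable A ->
  (\int[P]_(w in A) (M y t w)%:E)%E =
  (fine (P (A `&` Z t @^-1` [set y])) - \int[lebesgue_measure]_(u in `[0, t])
    \sum_x L u x y * fine (P (A `&` Z u @^-1` [set x])))%:E.
Proof.
move=> t0 mA; have rct w t' : 0 <= t' < t ->
    exists2 e, 0 < e & forall u, t' <= u < t' + e -> Z u w = Z t' w.
  by move=> /andP[t'0 _]; exact: rcZ.
have io x := occupation_integrable P rct (fun u a _ => mZ u a) (intL x y t0) x.
transitivity (\int[P]_(w in A) ((\1_(Z t @^-1` [set y]) w)%:E -
  (\sum_x \int[lebesgue_measure]_(u in `[0, t]) (L u x y * \1_(Z u @^-1` [set x]) w))%:E))%E.
  by apply: eq_integral => w _; rewrite generator_integralE.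
rewrite integralB//; last 2 first.
- by apply: integrableS (@integrable_indic _ _ _ P _ _) => //.
- apply: integrable_sumR => // x _; exact: integrableS (io x).
rewrite integral_indic// setIC EFinB fineK ?fin_num_measure//; last exact: measurableI.
congr (_ - _)%E; under eq_integral => w _ do rewrite -sumEFin.
rewrite integral_sum//; last by move=> x; exact: integrableS (io x).
rewrite Rintegral_sum//; last by move=> x; exact: forward_integrable.
rewrite -sumEFin; apply: eq_bigr => x _.
rewrite integral_occupation//; exact: intL.
Qed.

End forward.

(** * Sub-sigma-algebras and conditional expectations *)

Section sub_sigma_algebra.
Context d (T : measurableType d) (R : realType) (P : probability T R).
Variable G : set (set T).
Hypothesis mG : G `<=` measurable.

Lemma sub_sigma_measurable A : <<s G >> A -> measurable A.
Proof.
by move: A; apply: smallest_sub => //; exact: sigma_algebra_measurable.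
Qed.

Let mid : measurable_fun setT (id : T -> g_sigma_algebraType G).
Proof. by move=> _ A sA; rewrite setTI preimage_id; exact: sub_sigma_measurable. Qed.

Let idm : {mfun T >-> g_sigma_algebraType G} :=
  MeasurableFun.Pack (MeasurableFun.Class (isMeasurableFun.Build _ _ _ _ _ mid)).

(** The restriction of [P] to the sigma-algebra generated by [G], obtained as the law of the
    identity map into the coarser space. *)
Definition sub_probability : probability (g_sigma_algebraType G) R :=
  distribution P idm.

Lemma sub_measurable_fun d' (T' : measurableType d') (f : T -> T') :
  measurable_fun setT (f : g_sigma_algebraType G -> T') -> measurable_fun setT f.
Proof. by move=> mf; apply: (measurableT_comp mf mid). Qed.

Lemma sub_integrable (f : T -> \bar R) :
  sub_probability.-integrable setT (f : g_sigma_algebraType G -> \bar R) ->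
  P.-integrable setT f.
Proof.
move=> /integrableP[mf foo]; apply/integrableP; split; first exact: sub_measurable_fun.
apply: le_lt_trans foo; rewrite ge0_integral_pushforward//=.
by apply: measurableT_comp.
Qed.

Lemma sub_integral (f : T -> \bar R) A :
  sub_probability.-integrable setT (f : g_sigma_algebraType G -> \bar R) ->
  <<s G >> A ->
  (\int[sub_probability]_(w in A) f w = \int[P]_(w in A) f w)%E.
Proof.
move=> intf GA; rewrite integral_pushforward//=.
  exact: measurable_int intf.
apply: integrableS (sub_integrable intf) => //.
exact: sub_sigma_measurable.
Qed.

Lemma integrable_sub (f : T -> \bar R) :
  measurable_fun setT (f : g_sigma_algebraType G -> \bar R) ->
  P.-integrable setT f ->
  sub_probability.-integrable setT (f : g_sigma_algebraType G -> \bar R).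
Proof. by move=> mf intf; apply: integrable_pushforward. Qed.

(** Uniqueness of conditional expectations: the exceptional set is found in the coarser space, and a
    null set there is measurable and [P]-null. *)
Lemma sub_ae_eq (f g : T -> R) :
  measurable_fun setT (f : g_sigma_algebraType G -> R) ->
  measurable_fun setT (g : g_sigma_algebraType G -> R) ->
  P.-integrable setT (EFin \o f) -> P.-integrable setT (EFin \o g) ->
  (forall A, <<s G >> A ->
    (\int[P]_(w in A) (f w)%:E = \int[P]_(w in A) (g w)%:E)%E) ->
  {ae P, forall w, f w = g w}.
Proof.
move=> mf mg intf intg fg.
have sf : sub_probability.-integrable setT
    (EFin \o f : g_sigma_algebraType G -> \bar R).
  by apply: integrable_sub => //; exact/measurable_EFinP.
have sg : sub_probability.-integrable setT
    (EFin \o g : g_sigma_algebraType G -> \bar R).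
  by apply: integrable_sub => //; exact/measurable_EFinP.
have [|N [mN N0 H]] := integral_ae_eq measurableT sf (measurable_int _ sg).
  by move=> E _ mE; rewrite !sub_integral//; exact: fg.
exists N; split; [exact: sub_sigma_measurable|exact: N0|].
by apply: subset_trans H => w /= fgw; apply: contra_not fgw => /(_ I) [].
Qed.

(** The version is the Radon-Nikodym derivative of [A |-> P(A, B)] with respect to the restriction
    of [P]. It provides versions to which the consistency condition, quantified over all of them,
    can be applied. *)
Lemma cond_exp_exists B : measurable B ->
  exists Y : T -> R, cond_exp_version P <<s G >> (\1_B) Y.
Proof.
move=> mB.
have PB : (P B < +oo)%E by exact: (le_lt_trans (probability_le1 P mB)) (ltry 1).
have [nu nuE] : exists nu : {charge set (g_sigma_algebraType G) -> \bar R},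
    forall A, nu A = P (A `&` B).
  unshelve refine (ex_intro _ (pushforward
    (charge_of_finite_measure (mfrestr mB PB)) idm : {charge set _ -> \bar R}) _).
    exact: mid.
  by [].
have numu : nu `<< sub_probability.
  apply/null_content_dominatesP => A mA PA0; rewrite nuE.
  apply: (@subset_measure0 _ _ _ P _ A) => //; last exact: sub_sigma_measurable.
  by apply: measurableI => //; exact: sub_sigma_measurable.
have inY := Radon_Nikodym_integrable numu.
have finY := fun x => Radon_Nikodym_fin_num x numu.
exists (fine \o Radon_Nikodym nu sub_probability).
have YE : EFin \o (fine \o Radon_Nikodym nu sub_probability) = Radon_Nikodym nu sub_probability.
  by apply/funext => x/=; rewrite fineK.
split.
- move=> C mC.
  have /(_ measurableT C mC) : measurable_fun setT (fine \o Radon_Nikodym nu sub_probability).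
    by apply/measurable_EFinP; rewrite YE; exact: measurable_int inY.
  by rewrite setTI.
- by rewrite YE; exact: sub_integrable.
move=> A GA.
transitivity (nu A).
  rewrite (Radon_Nikodym_integral numu)// -sub_integral//; last first.
    by rewrite -/(EFin \o _) YE.
  by apply: eq_integral => w _; rewrite fineK.
by rewrite integral_indic ?nuE// 1?setIC//; exact: sub_sigma_measurable.
Qed.

End sub_sigma_algebra.

(** * The forward equation *)

Section forward_equation.
Context (R : realType) d (T : measurableType d) (P : probability T R).

(** Kolmogorov's forward equation, integrated in time and over an event. Letting [A] range over the
    whole past of [s] is what makes it as strong as the martingale property. *)
Definition forward_equation (S : finType) (F : R -> set (set T)) (Z : R -> T -> S)
    (L : R -> S -> S -> R) :=
  forall y s t A, 0 <= s -> s <= t -> F s A ->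
  fine (P (A `&` Z t @^-1` [set y])) = fine (P (A `&` Z s @^-1` [set y])) +
    \int[lebesgue_measure]_(u in `[s, t])
      \sum_x L u x y * fine (P (A `&` Z u @^-1` [set x])).

Context (S : finType) (Z : R -> T -> S) (L : R -> S -> S -> R).
Hypothesis rcZ : forall w t, 0 <= t ->
  exists2 e, 0 < e & forall u, t <= u < t + e -> Z u w = Z t w.
Hypothesis mZ : forall u a, measurable (Z u @^-1` [set a]).
Hypothesis intL : forall x y, Defs.locally_integrable (fun t => L t x y).

Lemma natural_generators_measurable t :
  [set A | exists s a, 0 <= s <= t /\ A = Z s @^-1` [set a]] `<=` measurable.
Proof. by move=> _ [s [a [_ ->]]]. Qed.

Lemma natural_filtration_measurable t A :
  natural_filtration Z t A -> measurable A.
Proof. exact/sub_sigma_measurable/natural_generators_measurable. Qed.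

Lemma natural_filtration_le s t : s <= t ->
  natural_filtration Z s `<=` natural_filtration Z t.
Proof.
move=> st; apply: smallest_sub => [|_ [u [a [/andP[u0 us] ->]]]].
  exact: smallest_sigma_algebra.
by apply: sub_sigma_algebra; exists u, a; rewrite u0 (le_trans us).
Qed.

Lemma natural_filtrationP t u a : 0 <= u <= t ->
  natural_filtration Z t (Z u @^-1` [set a]).
Proof. by move=> ut; apply: sub_sigma_algebra; exists u, a. Qed.

Lemma natural_filtrationI t A B : natural_filtration Z t A -> natural_filtration Z t B ->
  natural_filtration Z t (A `&` B).
Proof.
move=> FA FB.
exact: (@measurableI _ (g_sigma_algebraType
  [set A | exists s a, 0 <= s <= t /\ A = Z s @^-1` [set a]]) A B FA FB).
Qed.

Lemma natural_filtrationT t : natural_filtration Z t setT.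
Proof.
exact: (@measurableT _ (g_sigma_algebraType
  [set A | exists s a, 0 <= s <= t /\ A = Z s @^-1` [set a]])).
Qed.

Lemma forward_sum_integrable t A y : 0 <= t -> measurable A ->
  lebesgue_measure.-integrable `[0, t]
    (EFin \o (fun u => \sum_x L u x y * fine (P (A `&` Z u @^-1` [set x])))).
Proof.
move=> t0 mA; apply: integrable_sumR => // x _; exact: forward_integrable.
Qed.

(** The compensator integral over [[0, t]] splits at [s], and its part over [[0, s]] cancels. *)
Lemma martingale_forward_iff s t A y : 0 <= s -> s <= t -> measurable A ->
  (\int[P]_(w in A) (\1_(Z s @^-1` [set y]) w
    - \int[lebesgue_measure]_(u in `[0, s]) L u (Z u w) y)%:E =
   \int[P]_(w in A) (\1_(Z t @^-1` [set y]) w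
    - \int[lebesgue_measure]_(u in `[0, t]) L u (Z u w) y)%:E)%E <->
  fine (P (A `&` Z t @^-1` [set y])) = fine (P (A `&` Z s @^-1` [set y])) +
    \int[lebesgue_measure]_(u in `[s, t])
      \sum_x L u x y * fine (P (A `&` Z u @^-1` [set x])).
Proof.
move=> s0 st mA; have t0 := le_trans s0 st.
rewrite !generator_integral_set//.
rewrite (@Rintegral_itvcc_split _ _ 0 s t) ?s0//; last exact: forward_sum_integrable.
by split=> [[]|] => [E|->]; [|congr (_%:E)]; lra.
Qed.

Lemma has_generator_forward F : (forall t A, 0 <= t -> F t A -> measurable A) ->
  has_generator P F Z L -> forward_equation F Z L.
Proof.
move=> mF gen y s t A s0 st FA; have [_ _ /(_ A FA)] := gen y s t s0 st.
by move/(martingale_forward_iff y s0 st (mF _ _ s0 FA)).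
Qed.

Lemma generator_adapted y t (B : set R) : 0 <= t -> measurable B ->
  natural_filtration Z t ((fun w => \1_(Z t @^-1` [set y]) w
    - \int[lebesgue_measure]_(u in `[0, t]) L u (Z u w) y) @^-1` B).
Proof.
move=> t0 mB; set G := [set A | exists s a, 0 <= s <= t /\ A = Z s @^-1` [set a]].
have mG : G `<=` measurable by exact: natural_generators_measurable.
suff mM : measurable_fun setT ((fun w => \1_(Z t @^-1` [set y]) w
    - \int[lebesgue_measure]_(u in `[0, t]) L u (Z u w) y) : g_sigma_algebraType G -> R).
  by have := mM measurableT B mB; rewrite setTI.
apply: measurable_funB.
  apply: measurable_indic; apply: natural_filtrationP; exact/andP.
have -> : (fun w => \int[lebesgue_measure]_(u in `[0, t]) L u (Z u w) y) =
    (fun w => \sum_x \int[lebesgue_measure]_(u in `[0, t])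
      (L u x y * \1_(Z u @^-1` [set x]) w)).
  by apply/funext => w; rewrite (generator_integralE rcZ mZ intL).
apply: measurable_sum => x.
(* The occupation integral up to [t] uses only times in [[0, t]], so the measurability lemma applies
   with the sample space carrying the past of [t] as its sigma-algebra; this gives adaptedness. *)
apply: (@occupation_measurable _ _ _ (sub_probability P mG) _ _ _ _ _ _ (intL x y t0) x).
  by move=> w t' /andP[t'0 _]; exact: rcZ.
by move=> u a ut; exact: natural_filtrationP.
Qed.

Lemma forward_has_generator :
  forward_equation (natural_filtration Z) Z L ->
  has_generator P (natural_filtration Z) Z L.
Proof.
move=> fwd y s t s0 st; split.
- by move=> B mB; exact: generator_adapted.
- exact: generator_integrable.
- move=> A FA; apply/martingale_forward_iff => //.
    exact: natural_filtration_measurable FA.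
  exact: fwd.
Qed.

End forward_equation.

(** * Uniqueness for the linear integral equation *)

Lemma Rintegral_small (R : realType) (f : R -> R) (tm : R) :
  lebesgue_measure.-integrable `[0, tm] (EFin \o f) ->
  exists2 e : R, 0 < e & forall a b, 0 <= a -> a <= b -> b <= tm -> b <= a + e ->
    \int[lebesgue_measure]_(u in `[a, b]) `|f u| <= 1 / 2.
Proof.
move=> intf; have intf0 : lebesgue_measure.-integrable setT (EFin \o (f \_ `[0, tm])).
  by rewrite -restrict_EFin -integrable_mkcond.
(* Absolute continuity of the integral gives one [e] for all subintervals of [[0, tm]], wherever
   they lie. It asks for measure strictly below [e], hence the [e / 2] that follows. *)
have [|e [e0 He]] := @integral_normr_continuous _ _ _ _ _ intf0 (1/2); first lra.
exists (e / 2); first lra.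
move=> a b a0 ab btm bae.
have mab : (lebesgue_measure (`[a, b]%classic : set R) < e%:E)%E.
  rewrite lebesgue_measure_itv/= lte_fin.
  by case: ifPn => _; rewrite -?EFinB lte_fin//; lra.
have -> : \int[lebesgue_measure]_(u in `[a, b]) `|f u| =
    \int[lebesgue_measure]_(u in `[a, b]) `|(f \_ `[0, tm]) u|.
  apply: eq_Rintegral => u /[!inE]/=; rewrite in_itv/= => /andP[au ub].
  by rewrite patchE mem_set//= in_itv/= (le_trans a0 au) (le_trans ub btm).
exact/ltW/(He _ (measurable_itv _) mab).
Qed.

Section gronwall.
Context (R : realType) (S : finType) (L : R -> S -> S -> R).
Hypothesis intL : forall x y, Defs.locally_integrable (fun t => L t x y).
Variables (s T M : R) (q : R -> S -> R).
Hypothesis s0 : 0 <= s.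
Hypothesis qM : forall u x, s <= u <= T -> `|q u x| <= M.
Hypothesis intq : forall x y, lebesgue_measure.-integrable `[s, T]
  (EFin \o (fun u => L u x y * q u x)).
Hypothesis qE : forall t y, s <= t <= T ->
  q t y = \int[lebesgue_measure]_(u in `[s, t]) \sum_x L u x y * q u x.

(* No exponential is needed: the integral of |L| over any interval of a fixed
   length e is at most 1/2, so q vanishes on successive intervals of length e. *)
Lemma gronwall_eq0 t y : s <= t <= T -> q t y = 0.
Proof.
move=> stT; have T0 : 0 <= T by case/andP: stT => st tT; exact: le_trans s0 (le_trans st tT).
pose l u := \sum_x \sum_y `|L u x y|.
have intl : lebesgue_measure.-integrable `[0, T] (EFin \o l).
  apply: integrable_sumR => // x _; apply: integrable_sumR => // z _.
  by apply: integrable_norm; exact: intL.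
have l0 u : 0 <= l u by apply: sumr_ge0 => x _; apply: sumr_ge0.
have [e e0 He] := Rintegral_small intl.
have intS a b z : s <= a -> b <= T -> lebesgue_measure.-integrable `[a, b]
    (EFin \o (fun u => \sum_x L u x z * q u x)).
  move=> sa bT; apply: integrable_sumR => // x _; apply: integrableS (intq x z) => //.
  by apply: subset_itv; rewrite bnd_simp.
have M0 : 0 <= M by exact: le_trans (qM y stT).
have step n : forall u z, s <= u <= T -> u <= s + n%:R * e -> q u z = 0.
  elim: n => [|n IHn] u z suT une.
    have -> : u = s.
      move/andP: suT => [su _]; move: une; rewrite mul0r addr0 => us.
      by apply/eqP; rewrite eq_le su us.
    rewrite qE; last by move/andP: stT => [? ?]; rewrite lexx (@le_trans _ _ t).
    by rewrite set_itv1 Rintegral_set1.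
  set a := s + n%:R * e in IHn.
  have ne0 : 0 <= n%:R * e by rewrite mulr_ge0// ltW.
  (* Since [q] vanishes up to [a], the equation only integrates over [[a, v]], where the integral of
     [l] is at most 1/2: each substitution of a bound on [q] halves it. *)
  have small k : forall v x, s <= v <= T -> v <= a + e -> `|q v x| <= M / 2 ^+ k.
    elim: k => [|k IHk] v x svT vae; first by rewrite expr0 divr1 qM.
    have [va|av] := leP v a.
      by rewrite (IHn v x)// normr0 divr_ge0// exprn_ge0.
    have /andP[sv vT] := svT.
    rewrite qE// (@Rintegral_itvcc_split _ _ s a v); last 2 first.
    - by rewrite (ltW av) andbT /a lerDl.
    - exact: intS.
    have -> : \int[lebesgue_measure]_(w in `[s, a]) (\sum_x0 L w x0 x * q w x0) = 0.
      rewrite /Rintegral integral0_eq//= => w; rewrite in_itv/= => /andP[sw wa].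
      rewrite big1// => z' _; rewrite IHn ?mulr0// sw/= (le_trans wa)//.
      by rewrite (le_trans (ltW av)).
    rewrite add0r.
    have sa : s <= a by rewrite /a lerDl.
    have intlav : lebesgue_measure.-integrable `[a, v] (EFin \o l).
      apply: integrableS intl => //; apply: subset_itv; rewrite bnd_simp//.
      exact: le_trans s0 sa.
    apply: le_trans; first by apply: le_normr_Rintegral => //; exact: intS.
    apply: (@le_trans _ _ (\int[lebesgue_measure]_(u in `[a, v]) (`|l u| * (M / 2 ^+ k)))).
      apply: le_Rintegral => //.
      - by apply: integrable_norm => //; exact: intS.
      - by apply: eq_integrable (integrableZr _ (M / 2 ^+ k) (integrable_norm intlav)).
      move=> w; rewrite /= in_itv/= => /andP[aw wv].
      rewrite (ger0_norm (l0 w)) (le_trans (ler_norm_sum _ _ _))//.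
      rewrite /l mulr_suml; apply: ler_sum => z' _; rewrite normrM.
      apply: ler_pM => //; last first.
        by apply: IHk; rewrite ?(le_trans sa aw) ?(le_trans wv vT)// (le_trans wv).
      by rewrite (bigD1 x)//= lerDl sumr_ge0.
    rewrite RintegralZr//; last exact: integrable_norm.
    have -> : M / 2 ^+ k.+1 = 1 / 2 * (M / 2 ^+ k).
      by rewrite exprS; field; rewrite expf_neq0.
    apply: ler_wpM2r.
      by rewrite divr_ge0// exprn_ge0.
    by apply: He => //; [exact: le_trans sa|exact: ltW].
  apply/eqP; rewrite -normr_eq0; apply/eqP/le_anti; rewrite normr_ge0 andbT.
  rewrite leNgt; apply/negP => qu0.
  have uae : u <= a + e by rewrite (le_trans une)// /a -natr1 mulrDl mul1r addrA.
  (* With this [k], [M / |q u z| < k + 1 <= 2 ^ k], which contradicts the bound. *)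
  have := small (Num.truncn (M / `|q u z|)) u z suT uae.
  apply/negP; rewrite -ltNge ltr_pdivrMr ?exprn_gt0// mulrC -ltr_pdivrMr//.
  rewrite (lt_le_trans (truncnS_gt _))// -natrX ler_nat; exact: ltn_expl.
have [n Hn] : exists n : nat, t <= s + n%:R * e.
  exists (Num.truncn ((t - s) / e)).+1.
  rewrite -lerBlDl -ler_pdivrMr//; exact/ltW/truncnS_gt.
exact: step Hn.
Qed.
End gronwall.

(** * From the forward equation to the Markov property *)

Lemma fine_prob_itv (R : realType) d (T : measurableType d) (P : probability T R) A :
  measurable A -> 0 <= fine (P A) <= 1.
Proof.
move=> mA; rewrite fine_ge0//= -lee_fin fineK ?fin_num_measure//.
exact: probability_le1.
Qed.

Section forward_markov.
Context (R : realType) d (T : measurableType d) (P : probability T R).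
Context (S : finType) (Z : R -> T -> S) (L : R -> S -> S -> R).
Hypothesis rcZ : forall w t, 0 <= t ->
  exists2 e, 0 < e & forall u, t <= u < t + e -> Z u w = Z t w.
Hypothesis mZ : forall u a, measurable (Z u @^-1` [set a]).
Hypothesis intL : forall x y, Defs.locally_integrable (fun t => L t x y).

Lemma fun_of_state_adapted (g : S -> R) u t (B : set R) : 0 <= u <= t -> measurable B ->
  natural_filtration Z t ((fun w => g (Z u w)) @^-1` B).
Proof.
move=> ut mB; set G := [set A | exists s a, 0 <= s <= t /\ A = Z s @^-1` [set a]].
suff mM : measurable_fun setT ((fun w => g (Z u w)) : g_sigma_algebraType G -> R).
  by have := mM measurableT B mB; rewrite setTI.
have -> : (fun w => g (Z u w)) = (fun w => \sum_x g x * \1_(Z u @^-1` [set x]) w).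
  by apply/funext => w; rewrite -sum_indic_eq.
apply: measurable_sum => x; apply: measurable_funM; first exact: measurable_cst.
by apply: measurable_indic; exact: natural_filtrationP.
Qed.

Lemma fun_of_state_integrable (g : S -> R) u :
  P.-integrable setT (EFin \o (fun w => g (Z u w))).
Proof.
have -> : (fun w => g (Z u w)) = (fun w => \sum_x g x * \1_(Z u @^-1` [set x]) w).
  by apply/funext => w; rewrite -sum_indic_eq.
apply: integrable_sumR => // x _.
by apply: integrableZlR => //; exact: integrable_indic.
Qed.

Lemma fun_of_state_integral (g : S -> R) u A : measurable A ->
  (\int[P]_(w in A) (g (Z u w))%:E)%E =
  (\sum_x g x * fine (P (A `&` Z u @^-1` [set x])))%:E.
Proof.
move=> mA; rewrite -sumEFin.
under eq_integral => w _ do rewrite (sum_indic_eq (Z u) g) -sumEFin.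
rewrite integral_sum//; last first.
  move=> x; apply: integrableZlR => //.
  by apply: integrableS (integrable_indic P (mZ u x)).
apply: eq_bigr => x _; under eq_integral => w _ do rewrite EFinM.
rewrite integralZl//; last by apply: integrableS (integrable_indic P (mZ u x)).
rewrite integral_indic// setIC EFinM fineK// fin_num_measure//; exact: measurableI.
Qed.

Let p A u x := fine (P (A `&` Z u @^-1` [set x])).

Lemma forward_markov :
  forward_equation P (natural_filtration Z) Z L ->
  markov_wrt P (natural_filtration Z) Z.
Proof.
move=> fwd; split; first by move=> t t0 a; apply: natural_filtrationP; rewrite t0/=.
move=> s t s0 st y.
pose B x := Z s @^-1` [set x].
(* The transition probability [P(Z_t = y | Z_s = x)], read as 0 when [P(Z_s = x) = 0]. *)
pose g x := p (B x) t y / fine (P (B x)).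
exists g; split.
- by move=> C mC; apply: fun_of_state_adapted; rewrite ?s0/=.
- exact: fun_of_state_integrable.
move=> A FA; have mA := natural_filtration_measurable mZ FA.
rewrite fun_of_state_integral// integral_indic//.
rewrite -[RHS]fineK; last by rewrite fin_num_measure//; exact: measurableI.
congr (_%:E); rewrite setIC -/(p A t y).
pose c x := p A s x / fine (P (B x)).
(* c x is P(A | Z_s = x); it is 0 when P(Z_s = x) = 0, since then p A s x = 0. *)
pose q u z := p A u z - \sum_x c x * p (B x) u z.
(* [p A] and its mixture solve the same linear equation from time [s] on, with equal values at [s];
   their difference [q] falls under [gronwall_eq0]. *)
suff /eqP : q t y = 0.
  rewrite subr_eq0 => /eqP ->; apply: eq_bigr => x _.
  by rewrite /g /c -/(p A s x); ring.
have p01 C u x : measurable C -> 0 <= p C u x <= 1.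
  move=> mC; apply: fine_prob_itv; exact: measurableI.
have mB x : measurable (B x) by exact: mZ.
have FB x : natural_filtration Z s (B x) by apply: natural_filtrationP; rewrite s0/=.
have t0 := le_trans s0 st.
have intp C x z : measurable C -> lebesgue_measure.-integrable `[s, t]
    (EFin \o (fun u => L u x z * p C u x)).
  move=> mC; apply: integrableS (forward_integrable P rcZ mZ intL x z t0 mC) => //.
  by apply: subset_itv; rewrite bnd_simp.
have intq x z : lebesgue_measure.-integrable `[s, t] (EFin \o (fun u => L u x z * q u x)).
  have -> : EFin \o (fun u => L u x z * q u x) =
    ((EFin \o (fun u => L u x z * p A u x)%R) \-
     (EFin \o (fun u => \sum_y0 c y0 * (L u x z * p (B y0) u x))%R))%E.
    apply/funext => u /=; rewrite -EFinB /q mulrBr mulr_sumr; congr (_ - _)%:E.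
    by apply: eq_bigr => y0 _; ring.
  apply: integrableB => //; first exact: intp.
  apply: integrable_sumR => // y0 _.
  apply: integrableZlR => //.
  exact: intp.
have qs z : q s z = 0.
  rewrite /q (bigD1 z)//= [X in _ - (_ + X)]big1 ?addr0; last first.
    move=> x xz; rewrite /p (_ : B x `&` _ = set0) ?measure0 ?mulr0//.
    rewrite -subset0 => w [/= -> zz]; by rewrite zz eqxx in xz.
  rewrite {2}/p setIid /c.
  have [Bz0|Bz0] := eqVneq (fine (P (B z))) 0; last by rewrite divfK// subrr.
  rewrite Bz0 mulr0 subr0; apply/le_anti.
  have /andP[-> _] := p01 A s z mA; rewrite andbT -Bz0.
  rewrite fine_le ?fin_num_measure//; first exact: measurableI.
  by rewrite le_measure ?inE//; exact: measurableI.
apply: (@gronwall_eq0 _ _ _ intL s t (1 + \sum_x `|c x|) q s0) => //; last by rewrite st lexx.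
- move=> u x _; rewrite /q (le_trans (ler_normB _ _))// lerD//.
    by have /andP[p0 p1] := p01 A u x mA; rewrite ger0_norm.
  rewrite (le_trans (ler_norm_sum _ _ _))//; apply: ler_sum => z _.
  rewrite normrM ler_piMr//.
  by have /andP[p0 p1] := p01 _ u x (mB z); rewrite ger0_norm.
- move=> u z /andP[su ut].
  have pE C : natural_filtration Z s C -> p C u z = p C s z +
      \int[lebesgue_measure]_(v in `[s, u]) \sum_x L v x z * p C v x.
    by move=> FC; exact: fwd.
  have sub C x : measurable C -> lebesgue_measure.-integrable `[s, u]
      (EFin \o (fun v => L v x z * p C v x)).
    move=> mC; apply: integrableS (intp C x z mC) => //.
    by apply: subset_itv; rewrite bnd_simp.
  (* Subtracting [q s z], which is 0, cancels the initial values of all the forward equations and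
     leaves their integrals. *)
  rewrite -[LHS]subr0 -[X in _ - X](qs z) /q pE//.
  under eq_bigr => x _ do rewrite pE// mulrDr.
  rewrite big_split/= [LHS](_ : _ =
    \int[lebesgue_measure]_(v in `[s, u]) (\sum_x L v x z * p A v x) -
    \sum_x c x * \int[lebesgue_measure]_(v in `[s, u]) (\sum_x0 L v x0 z * p (B x) v x0)).
    2: by ring.
  have isum C : measurable C -> lebesgue_measure.-integrable `[s, u]
      (EFin \o (fun v => \sum_x L v x z * p C v x)).
    by move=> mC; apply: integrable_sumR => // x _; exact: sub.
  have icsum x : lebesgue_measure.-integrable `[s, u]
      (EFin \o (fun v => c x * \sum_x0 L v x0 z * p (B x) v x0)).
    by apply: integrableZlR => //; exact: isum.
  have -> : \sum_x c x * \int[lebesgue_measure]_(v in `[s, u]) (\sum_x0 L v x0 z * p (B x) v x0) =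
      \sum_x \int[lebesgue_measure]_(v in `[s, u]) (c x * (\sum_x0 L v x0 z * p (B x) v x0)).
    by apply: eq_bigr => x _; rewrite RintegralZl//; exact: isum.
  rewrite -Rintegral_sum// -RintegralB//; last first.
  - by apply: integrable_sumR => // x _; exact: icsum.
  - exact: isum.
  apply: eq_Rintegral => v _.
  rewrite /q; under [in RHS]eq_bigr => x _ do rewrite mulrBr mulr_sumr.
  rewrite sumrB; congr (_ - _); rewrite exchange_big/=.
  apply: eq_bigr => x _; rewrite mulr_sumr; apply: eq_bigr => x' _; ring.
Qed.
End forward_markov.

(** * Almost-everywhere arguments *)

Lemma ae_mono (R : realType) d (T : measurableType d) (mu : {measure set T -> \bar R})
    (A B : T -> Prop) : {ae mu, forall x, A x} -> (forall x, A x -> B x) ->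
  {ae mu, forall x, B x}.
Proof. by move=> muA AB; apply: filterS muA. Qed.

Lemma ae_forall_fin (R : realType) d (T : measurableType d) (mu : {measure set T -> \bar R})
    (I : finType) (A : I -> T -> Prop) : (forall i, {ae mu, forall x, A i x}) ->
  {ae mu, forall x, forall i, A i x}.
Proof. by move=> muA; apply: filter_forall. Qed.

Lemma Rintegral_ae_eq (R : realType) d (T : measurableType d)
    (mu : {measure set T -> \bar R}) (D : set T) (f g : T -> R) :
  measurable D -> mu.-integrable D (EFin \o f) -> mu.-integrable D (EFin \o g) ->
  {ae mu, forall x, D x -> f x = g x} ->
  \int[mu]_(x in D) f x = \int[mu]_(x in D) g x.
Proof.
move=> mD /measurable_int mf /measurable_int mg fg; congr fine.
apply: ae_eq_integral => //.
by apply: filterS fg => x fg Dx /=; rewrite fg.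
Qed.

Lemma ae_forall_count (R : realType) d (T : measurableType d) (mu : {measure set T -> \bar R})
    (I : countType) (A : I -> T -> Prop) : (forall i, {ae mu, forall x, A i x}) ->
  {ae mu, forall x, forall i, A i x}.
Proof.
move=> muA; pose B n x := if unpickle n is Some i then A i x else True.
have muB n : {ae mu, forall x, B n x}.
  by rewrite /B; case: unpickle => [i|]; [exact: muA|exact: aeW].
by apply: ae_mono (ae_foralln muB) _ => x Bx i; have := Bx (pickle i); rewrite /B pickleK.
Qed.

Lemma ae_and (R : realType) d (T : measurableType d) (mu : {measure set T -> \bar R})
    (A B : T -> Prop) : {ae mu, forall x, A x} -> {ae mu, forall x, B x} ->
  {ae mu, forall x, A x /\ B x}.
Proof. by move=> muA muB; apply: filterS2 muA muB. Qed.

(** On nonnegative reals the inverse is the real power of exponent -1, also at 0 where both are 0,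
    and real powers are measurable. *)
Lemma measurable_inv_ge0 (R : realType) d (T : measurableType d) (D : set T) (f : T -> R) :
  (forall x, 0 <= f x) -> measurable_fun D f -> measurable_fun D (fun x => (f x)^-1).
Proof.
move=> f0 mf; have -> : (fun x => (f x)^-1) = (fun x => f x `^ (-1)).
  by apply/funext => x; rewrite powR_inv1.
by apply: (measurableT_comp (f := fun x : R => x `^ (-1))) => //; exact: measurable_powR.
Qed.

(** The one-sided intervals shrink nicely to their left end, so the differentiation theorem covers
    them. It is applied to the truncations of [f] to [[0, N]] for all integers [N] at once. *)
Lemma right_lebesgue_differentiation (R : realType) (f : R -> R) :
  Defs.locally_integrable f ->
  {ae lebesgue_measure, forall s : R, 0 <= s ->
    n.+1%:R * \int[lebesgue_measure]_(u in `[s, s + n.+1%:R^-1]) f u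
      @[n --> \oo] --> f s}.
Proof.
move=> intf.
have aeN N : {ae lebesgue_measure, forall s : R, lebesgue_pt (f \_ `[0, N%:R]) s}.
  apply: lebesgue_differentiation; apply: open_integrable_locally => //.
    exact: openT.
  by rewrite -restrict_EFin -integrable_mkcond//; exact: intf.
apply: ae_mono (ae_foralln aeN) _ => s H s0.
(* Large enough for every interval [[s, s + 1/(n+1)]] to lie in [[0, N]]. *)
pose N := (Num.truncn s).+2; have {H} := H N.
have sN : s + 1 <= N%:R by rewrite /N -natr1 lerD2r ltW// truncnS_gt.
pose E (x : R) n := `[x, x + n.+1%:R^-1]%classic.
have h0 n : 0 < n.+1%:R^-1 :> R by rewrite invr_gt0.
have muE y n : lebesgue_measure (E y n) = (n.+1%:R^-1)%:E.
  by rewrite /E lebesgue_measure_itv/= lte_fin ltrDl h0 -EFinD addrC addKr.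
have nice_E y : nicely_shrinking y (E y).
  split=> [n|]; first exact: measurable_itv.
  have p0 n : 0 < 2 * n.+1%:R^-1 :> R by rewrite mulr_gt0.
  (* The radius is twice the length of the interval, to fit the closed interval in an open ball; the
     ball then has 4 times the measure of the interval. *)
  exists (4, fun n => PosNum (p0 n)); split => //=.
  - rewrite -[X in _ --> X](mulr0 (2 : R)).
    by apply: cvgM; [exact: cvg_cst|exact: cvg_harmonic].
  - move=> n z; rewrite /E/= in_itv/= /ball/= => /andP[yz zy].
    rewrite ltr_distlC; have := h0 n; move: zy yz; set h := _^-1; lra.
  - move=> n; rewrite (lebesgue_measure_ball _ (ltW (p0 n))) muE -EFinM lee_fin.
    have := h0 n; set h := _^-1; rewrite mulr2n; lra.
have locf : locally_integrable setT (f \_ `[0, N%:R]).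
  apply: open_integrable_locally; first exact: openT.
  by rewrite -restrict_EFin -integrable_mkcond//; exact: intf.
move=> fs; have := nice_lebesgue_differentiation nice_E locf fs.
have -> : (f \_ `[0, N%:R]) s = f s.
  by rewrite patchE mem_set//= in_itv/= s0 (le_trans _ sN)// lerDl.
have int1 n : (\int[lebesgue_measure]_(y in E s n) ((f \_ `[0, N%:R]) y)%:E =
    (\int[lebesgue_measure]_(u in `[s, s + n.+1%:R^-1]) f u)%:E)%E.
  have sub : E s n `<=` `[0, N%:R].
    apply: subset_itv; rewrite bnd_simp//.
    by rewrite (le_trans _ sN)// lerD2l invf_le1// ler1n.
  rewrite /Rintegral fineK; last first.
    apply: integrable_fin_num => //; apply: integrableS (intf N%:R _) => //.
  apply: eq_integral => u us; rewrite patchE mem_set//; apply: sub; exact: set_mem.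
under eq_fun => n do rewrite muE int1 inver gt_eqF// -EFinM invrK.
by move/fine_cvgP => [_].
Qed.

(** * Probability of a change of state over a short time *)

Lemma fine_prob_dist_le (R : realType) d (T : measurableType d) (P : probability T R)
    (A C D : set T) : measurable A -> measurable C -> measurable D ->
  C `<=` A `|` D -> A `<=` C `|` D ->
  `|fine (P A) - fine (P C)| <= fine (P D).
Proof.
move=> mA mC mD CAD ACD.
have le U V : measurable U -> measurable V -> U `<=` V `|` D ->
    fine (P U) <= fine (P V) + fine (P D).
  move=> mU mV UVD; rewrite -fineD ?fin_num_measure//.
  rewrite fine_le ?fin_numD ?fin_num_measure//.
  apply: (@le_trans _ _ (P (V `|` D))).
    by rewrite le_measure ?inE//; exact: measurableU.
  exact: measureU2.
by rewrite ler_distlC; have := le _ _ mA mC ACD; have := le _ _ mC mA CAD; lra.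
Qed.

Section mismatch.
Context (R : realType) d (T : measurableType d) (P : probability T R).
Context (S : finType) (Z : R -> T -> S).
Hypothesis rcZ : forall w t, 0 <= t ->
  exists2 e, 0 < e & forall u, t <= u < t + e -> Z u w = Z t w.
Hypothesis mZ : forall u a, measurable (Z u @^-1` [set a]).

Lemma mismatch_measurable u s : measurable [set w | Z u w <> Z s w].
Proof.
rewrite (_ : [set w | _] = \bigcup_a (Z u @^-1` [set a] `\` Z s @^-1` [set a])).
  apply: fin_bigcup_measurable => [|a _]; first exact: finite_finset.
  exact: measurableD.
apply/seteqP; split=> [w/= us|w [a _ [/= <- us]] us']; last exact: us.
by exists (Z u w) => //; split => // /esym.
Qed.

(** By right-constancy the indicator of a mismatch tends to 0 on every path as [u] decreases to [s];
    dominated convergence carries this over to probabilities. *)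
Lemma mismatch_prob_small s e : 0 <= s -> 0 < e ->
  exists2 h, 0 < h & forall u, s <= u < s + h ->
    fine (P [set w | Z u w <> Z s w]) <= e.
Proof.
move=> s0 e0.
have : fine (P [set w | Z u w <> Z s w]) @[u --> s^'+] --> (0 : R).
  apply/cvg_at_rightP => u [us ucvg].
  have := @dominated_convergence _ _ _ P setT measurableT
    (fun n w => (\1_[set w | Z (u n) w <> Z s w] w)%:E) (cst 0%E) (cst 1%E).
  case.
  - by move=> n; apply/measurable_EFinP/measurable_indic/mismatch_measurable.
  - exact: measurable_cst.
  - apply: aeW => w _; apply: cvg_near_cst.
    have [r r0 Hr] := rcZ w s0.
    have /cvgrPdist_lt/(_ _ r0) := ucvg; apply: filterS => n.
    rewrite ltr_distlC => /andP[_ unr].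
    by rewrite indicE memNset//= => neq; apply: neq; apply: Hr; rewrite ltW/=.
  - exact: (finite_measure_integrable_cst P 1).
  - by apply: aeW => w n _; rewrite /= lee_fin indicE; case: (_ \in _); rewrite ?normr1 ?normr0.
  move=> _ _; rewrite integral0.
  under eq_fun => n do (rewrite integral_indic// ?setIT; last exact: mismatch_measurable).
  by move/fine_cvgP => [].
move=> /cvgrPdist_le/(_ _ e0)[r /= r0 Hr]; exists r => // u /andP[su usr].
have [->|us] := eqVneq u s.
  rewrite (_ : [set w | _] = set0) ?measure0//=; first exact: ltW.
  by rewrite -subset0 => w /=.
have su' : s < u by rewrite lt_neqAle eq_sym us.
have := Hr u; rewrite sub0r normrN ger0_norm ?fine_ge0//; apply => //.
by rewrite /ball/= ltr_distlC; lra.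
Qed.
End mismatch.

(** * Pi-systems and rational cylinders *)

Lemma integral_pi_system_eq0 (R : realType) d (T : measurableType d)
    (mu : {measure set T -> \bar R}) (G : set (set T)) (f : T -> \bar R) :
  setI_closed G -> G setT -> G `<=` measurable -> mu.-integrable setT f ->
  (forall A, G A -> (\int[mu]_(x in A) f x = 0)%E) ->
  forall A, <<s G >> A -> (\int[mu]_(x in A) f x = 0)%E.
Proof.
move=> GI GT Gm intf G0 A.
(* [D] is a Dynkin system: complements use that the integral over [setT] is 0, countable disjoint
   unions use integrability. *)
pose D := [set A | measurable A /\ (\int[mu]_(x in A) f x = 0)%E].
suff : <<s G >> `<=` D by move=> /[apply] -[].
rewrite -setI_closed_g_dynkin_g_sigma_algebra//; apply: smallest_sub; last first.
  by move=> B GB; split; [exact: Gm|exact: G0].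
split.
- by split => //; exact: G0.
- move=> B [mB B0]; split; first exact: measurableC.
  have := G0 _ GT; rewrite -(setUv B) integral_setU//; last 3 first.
  + exact: measurableC.
  + by rewrite setUv; exact: measurable_int intf.
  + by apply/disj_setPS; rewrite setICr.
  by rewrite B0 add0e.
- move=> F tF FD; have mF k : measurable (F k) by case: (FD k).
  split; first exact: bigcupT_measurable.
  rewrite integral_bigcup//; last first.
    by apply: integrableS intf => //; exact: bigcupT_measurable.
  by apply: eseries0 => k _ _; case: (FD k).
Qed.

Section rational_cylinders.
Context (R : realType) d (T : measurableType d) (S : finType) (Z : R -> T -> S).
Hypothesis rcZ : forall w t, 0 <= t ->
  exists2 e, 0 < e & forall u, t <= u < t + e -> Z u w = Z t w.
Hypothesis mZ : forall u a, measurable (Z u @^-1` [set a]).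

(** Lists of constraints, possibly redundant or contradictory, form a countable type, and
    concatenating them intersects the cylinders. *)
Definition rat_cylinder (l : seq (rat * S)) : set T :=
  [set w | all (fun qa => Z (ratr qa.1) w == qa.2) l].

Definition state_cylinder t (l : seq S) : set T := [set w | all (fun a => Z t w == a) l].

Definition rat_before (t : R) (l : seq (rat * S)) :=
  all (fun qa => 0 <= (ratr qa.1 : R) <= t) l.

(* The state at t itself is kept apart: it is not determined by earlier times. *)
Definition rat_pi_system t : set (set T) :=
  [set A | exists l m, rat_before t l /\ A = rat_cylinder l `&` state_cylinder t m].

Lemma rat_cylinder_measurable l : measurable (rat_cylinder l).
Proof.
elim: l => [|[q a] l IHl]; first by rewrite (_ : rat_cylinder _ = setT) //; apply/seteqP; split.
rewrite (_ : rat_cylinder _ = Z (ratr q) @^-1` [set a] `&` rat_cylinder l).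
  exact: measurableI.
apply/seteqP; split => [w/= /andP[/eqP]//|w [/= Zw lw]].
by rewrite /rat_cylinder /= Zw eqxx.
Qed.

Lemma rat_cylinder_adapted t l : rat_before t l -> natural_filtration Z t (rat_cylinder l).
Proof.
elim: l => [_|[q a] l IHl /= /andP[qt lt]].
  by rewrite (_ : rat_cylinder _ = setT); [exact: natural_filtrationT|apply/seteqP; split].
rewrite (_ : rat_cylinder _ = Z (ratr q) @^-1` [set a] `&` rat_cylinder l).
  by apply: natural_filtrationI; [exact: natural_filtrationP|exact: IHl].
apply/seteqP; split => [w/= /andP[/eqP]//|w [/= Zw lw]].
by rewrite /rat_cylinder /= Zw eqxx.
Qed.

Lemma state_cylinder_adapted t m : 0 <= t -> natural_filtration Z t (state_cylinder t m).
Proof.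
move=> t0; elim: m => [|a l IHl].
  by rewrite (_ : state_cylinder _ _ = setT); [exact: natural_filtrationT|apply/seteqP; split].
rewrite (_ : state_cylinder _ _ = Z t @^-1` [set a] `&` state_cylinder t l).
  by apply: natural_filtrationI => //; apply: natural_filtrationP; rewrite t0/=.
by apply/seteqP; split => [w/andP[/eqP]//|w [Zw lw]]; apply/andP; split => //; exact/eqP.
Qed.

Lemma rat_pi_systemI t : setI_closed (rat_pi_system t).
Proof.
move=> _ _ [l [m [lt ->]]] [l' [m' [lt' ->]]]; exists (l ++ l'), (m ++ m'); split.
  by rewrite /rat_before all_cat; apply/andP.
have catE (A : Type) (f : A -> T -> bool) (k k' : seq A) :
    [set w | all (f^~ w) k] `&` [set w | all (f^~ w) k'] = [set w | all (f^~ w) (k ++ k')].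
  apply/seteqP; split => [w [kw k'w]|w]; rewrite /= all_cat; first exact/andP.
  by move=> /andP.
rewrite setIACA (catE _ (fun qa w => Z (ratr qa.1) w == qa.2)).
by rewrite (catE _ (fun a w => Z t w == a)).
Qed.

Lemma rat_pi_systemT t : rat_pi_system t setT.
Proof. by exists [::], [::]; split => //; apply/seteqP; split. Qed.

(** For [u < t], right-constancy makes [Z_u = a] the limit inferior of the events [Z_q = a] along
    rationals [q] decreasing to [u] inside []u, t[]. *)
Lemma natural_filtration_rat t : 0 <= t ->
  natural_filtration Z t `<=` <<s rat_pi_system t >>.
Proof.
move=> t0; apply: smallest_sub; first exact: smallest_sigma_algebra.
move=> _ [u [a [/andP[u0 ut] ->]]].
have [tu|ut'] := leP t u.
  have -> : u = t by apply/eqP; rewrite eq_le ut tu.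
  apply: sub_sigma_algebra; exists [::], [:: a]; split => //.
  apply/seteqP; split => [w Zw|w [_]]; last by rewrite /state_cylinder/= andbT => /eqP.
  by split => //; rewrite /state_cylinder/= andbT; exact/eqP.
have ex n : exists q : rat, u < ratr q < Num.min t (u + n.+1%:R^-1).
  have [|q] := @rat_in_itvoo R u (Num.min t (u + n.+1%:R^-1)).
    by rewrite lt_min ut' ltrDl invr_gt0/=.
  by rewrite in_itv; exists q.
pose q n := sval (cid (ex n)).
have qP n : u < ratr (q n) < Num.min t (u + n.+1%:R^-1) by rewrite /q; case: cid.
have cyl n : Z (ratr (q n)) @^-1` [set a] = rat_cylinder [:: (q n, a)] `&` state_cylinder t [::].
  apply/seteqP; split => [w Zw|w []]; last by rewrite /rat_cylinder/= andbT => /eqP.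
  by split => //; rewrite /rat_cylinder/= andbT; exact/eqP.
have eq w : exists N, forall n, (N <= n)%N -> Z (ratr (q n)) w = Z u w.
  have [e e0 He] := rcZ w u0.
  exists (Num.truncn e^-1) => n Nn; apply: He.
  have /andP[uq] := qP n; rewrite lt_min => /andP[_ qe]; rewrite (ltW uq)/=.
  rewrite (lt_trans qe)// ltrD2l invf_plt ?posrE//.
  by rewrite (lt_le_trans (truncnS_gt _))// ler_nat ltnS.
have -> : Z u @^-1` [set a] = \bigcup_N \bigcap_n (Z (ratr (q (N + n)%N)) @^-1` [set a]).
  apply/seteqP; split => [w /= Zu|w [N _ H]/=]; have [M HM] := eq w.
    by exists M => // n _ /=; rewrite HM ?leq_addr.
  by rewrite -(HM (N + M)%N (leq_addl _ _)); exact: H.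
apply: (@bigcup_measurable _ (g_sigma_algebraType (rat_pi_system t))) => N _.
apply: (@bigcap_measurable _ (g_sigma_algebraType (rat_pi_system t))) => // n _.
apply: sub_sigma_algebra; rewrite cyl; exists [:: (q (N + n)%N, a)], [::]; split => //=.
have /andP[uq] := qP (N + n)%N; rewrite lt_min => /andP[qt _].
by rewrite (le_trans u0 (ltW uq)) (ltW qt).
Qed.

End rational_cylinders.

(** * Components of a chain with a product state space *)

Lemma diag_complete_locally_integrable (R : realType) (S : finType) (L : R -> S -> S -> R) :
  (forall x y, x != y -> Defs.locally_integrable (fun t => L t x y)) ->
  forall x y, Defs.locally_integrable (fun t => diag_complete L t x y).
Proof.
move=> intL x y t t0; rewrite /diag_complete.
case: (eqVneq x y) => xy; last exact: intL.
have : lebesgue_measure.-integrable `[0, t]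
    (EFin \o (fun u => -1 * \sum_(z | z != x) L u x z)).
  apply: integrableZlR => //; apply: integrable_sumR => // z zx; apply: intL => //.
  by rewrite eq_sym.
by apply: eq_integrable => // u _ /=; rewrite mulN1r.
Qed.

Lemma prob_partition (R : realType) d (T : measurableType d) (P : probability T R)
    (S : finType) (Z : T -> S) A :
  (forall a, measurable (Z @^-1` [set a])) -> measurable A ->
  fine (P A) = \sum_x fine (P (A `&` Z @^-1` [set x])).
Proof.
move=> mZ mA.
have := fun_of_state_integral P (Z := fun=> Z) (fun _ a => mZ a) (cst 1) (0 : R) mA.
rewrite /cst; under [in X in _ = X -> _]eq_bigr do rewrite mul1r.
by rewrite integral_cst// mul1e => /(congr1 fine).
Qed.

Section pair.
Context (R : realType) d (T : measurableType d) (P : probability T R).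
Context (S1 S2 : finType) (X1 : R -> T -> S1) (X2 : R -> T -> S2).
Context (Lam : R -> S1 * S2 -> S1 * S2 -> R).
Hypothesis mX1 : forall t a, measurable (X1 t @^-1` [set a]).
Hypothesis mX2 : forall t a, measurable (X2 t @^-1` [set a]).
Hypothesis cadX : forall w, cadlag_fin (fun t => pair_process X1 X2 t w).
Hypothesis genLam : is_generator_fun Lam.
Local Notation XX := (pair_process X1 X2).

Lemma pair_right_constant w t : 0 <= t ->
  exists2 e, 0 < e & forall u, t <= u < t + e -> XX u w = XX t w.
Proof. by move=> t0; have [] := cadX w t0. Qed.

Lemma fst_right_constant w t : 0 <= t ->
  exists2 e, 0 < e & forall u, t <= u < t + e -> X1 u w = X1 t w.
Proof.
by move=> /(pair_right_constant w)[e e0 He]; exists e => // u /He[].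
Qed.

Lemma pair_preimage u x : XX u @^-1` [set x] = X1 u @^-1` [set x.1] `&` X2 u @^-1` [set x.2].
Proof.
by apply/seteqP; split => [w/= <-//|w /= []]; rewrite /pair_process; case: x => x1 x2 /= -> ->.
Qed.

Lemma pair_measurable u x : measurable (XX u @^-1` [set x]).
Proof. by rewrite pair_preimage; exact: measurableI. Qed.

Lemma pair_locally_integrable x y : Defs.locally_integrable (fun t => Lam t x y).
Proof. by case: genLam. Qed.

Lemma fst_preimage u x1 : X1 u @^-1` [set x1] = \bigcup_x2 (XX u @^-1` [set (x1, x2)]).
Proof.
apply/seteqP; split => [w/= <-|w [x2 _]]; first by exists (X2 u w).
by rewrite pair_preimage => -[].
Qed.

Lemma fst_filtration t : natural_filtration X1 t `<=` natural_filtration XX t.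
Proof.
apply: smallest_sub => [|_ [u [a [ut ->]]]]; first exact: smallest_sigma_algebra.
set G := [set A | exists s a, 0 <= s <= t /\ A = XX s @^-1` [set a]].
rewrite fst_preimage.
apply: (@fin_bigcup_measurable _ (g_sigma_algebraType G)) => [|x2 _].
  exact: finite_finset.
exact: natural_filtrationP.
Qed.

Local Notation p1 A u x1 := (fine (P (A `&` X1 u @^-1` [set x1]))).
Local Notation p A u x1 x2 := (fine (P (A `&` XX u @^-1` [set (x1, x2)]))).
(** Total rate from [(x1, x2)] to the states above [y1]; for [y1 = x1] it includes the diagonal
    entry of [Lam]. *)
Local Notation c u x1 x2 y1 := (\sum_y2 Lam u (x1, x2) (y1, y2)).

Lemma prob_fst_sum A u x1 : measurable A -> p1 A u x1 = \sum_x2 p A u x1 x2.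
Proof.
move=> mA; rewrite (prob_partition P (mX2 u))//; last exact: measurableI.
by apply: eq_bigr => x2 _; rewrite pair_preimage setIA.
Qed.

(** * The forward equation of the first coordinate, and sufficiency *)

Hypothesis fwdX : forward_equation P (natural_filtration XX) XX Lam.

Lemma pair_sum_integrable A t y1 : 0 <= t -> measurable A ->
  lebesgue_measure.-integrable `[0, t]
    (EFin \o (fun u => \sum_x1 \sum_x2 c u x1 x2 y1 * p A u x1 x2)).
Proof.
move=> t0 mA; apply: integrable_sumR => // x1 _; apply: integrable_sumR => // x2 _.
have : lebesgue_measure.-integrable `[0, t] (EFin \o (fun u =>
    \sum_y2 Lam u (x1, x2) (y1, y2) * p A u x1 x2)).
  apply: integrable_sumR => // y2 _; apply: forward_integrable => //.
  - exact: pair_right_constant.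
  - exact: pair_measurable.
  - exact: pair_locally_integrable.
by apply: eq_integrable => // u _ /=; rewrite -mulr_suml.
Qed.

(** Sum of the forward equations of the pair over the second coordinate. It is not yet closed in
    [X1]: the rates still depend on [x2]. *)
Lemma fst_forward y1 s t A : 0 <= s -> s <= t -> natural_filtration XX s A ->
  p1 A t y1 = p1 A s y1 + \int[lebesgue_measure]_(u in `[s, t])
    (\sum_x1 \sum_x2 c u x1 x2 y1 * p A u x1 x2).
Proof.
move=> s0 st FA; have mA := natural_filtration_measurable pair_measurable FA.
rewrite !prob_fst_sum//.
under eq_bigr => y2 _ do rewrite (fwdX (y1, y2) s0 st FA).
rewrite big_split/=; congr (_ + _).
rewrite -Rintegral_sum//; last first.
  move=> y2.
  apply: integrableS (forward_sum_integrable P pair_right_constant pair_measurable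
    pair_locally_integrable (y1, y2) (le_trans s0 st) mA) => //.
  by apply: subset_itv; rewrite bnd_simp.
apply: eq_Rintegral => u _; rewrite exchange_big/= [RHS]pair_bigA/=.
by apply: eq_bigr => -[x1 x2] _ /=; rewrite -mulr_suml.
Qed.

(** The condition is integrated over [A] and [X1_u = x1], an event of the past of [X1], where a
    version of the conditional expectation may be replaced by the indicator. The null set of times
    does not depend on [A]. *)
Lemma consistency_prob L1 x1 y1 : consistency_condition P X1 X2 Lam L1 -> x1 != y1 ->
  {ae lebesgue_measure, forall u : R, 0 <= u -> forall A, natural_filtration X1 u A ->
    \sum_x2 c u x1 x2 y1 * p A u x1 x2 = L1 u x1 y1 * p1 A u x1}.
Proof.
move=> [_ H] xy.
have exY u x2 : exists Y, cond_exp_version P (natural_filtration X1 u) (\1_(X2 u @^-1` [set x2])) Y.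
  by apply: cond_exp_exists => //; exact: natural_generators_measurable.
have [Y HY] : exists Y : R -> S2 -> T -> R, forall u x2,
    cond_exp_version P (natural_filtration X1 u) (\1_(X2 u @^-1` [set x2])) (Y u x2).
  exists (fun u x2 => sval (cid (exY u x2))) => u x2; by case: cid.
apply: ae_mono (H _ _ xy Y (fun u x2 _ => HY u x2)) _ => u /= + u0 A FA => /(_ u0) ae.
have mA := natural_filtration_measurable mX1 FA.
have FAx : natural_filtration X1 u (A `&` X1 u @^-1` [set x1]).
  by apply: natural_filtrationI => //; apply: natural_filtrationP; rewrite u0/=.
have mAx := natural_filtration_measurable mX1 FAx.
have intY x2 : P.-integrable (A `&` X1 u @^-1` [set x1]) (EFin \o Y u x2).
  by have [_ iY _] := HY u x2; exact: integrableS iY.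
have E : \int[P]_(w in A `&` X1 u @^-1` [set x1]) (\sum_x2 c u x1 x2 y1 * Y u x2 w) =
         \int[P]_(w in A `&` X1 u @^-1` [set x1]) (cst (L1 u x1 y1) w).
  apply: Rintegral_ae_eq => //.
  - by apply: integrable_sumR => // x2 _; exact: integrableZlR.
  - exact: finite_measure_integrable_cst.
  apply: filterS ae => w + [_ /= Xx1]; rewrite indicE mem_set// !mul1r => <-.
  by apply: eq_bigr => x2 _; rewrite mulr_suml.
move: E; rewrite Rintegral_cst// Rintegral_sum//; last by move=> x2; exact: integrableZlR.
move=> <-; apply: eq_bigr => x2 _; rewrite RintegralZl//; congr (_ * _).
have [_ _ /(_ _ FAx) E] := HY u x2.
by rewrite /Rintegral E integral_indic// pair_preimage setIA setIC.
Qed.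

Lemma consistency_forward L1 : consistency_condition P X1 X2 Lam L1 ->
  forward_equation P (natural_filtration X1) X1 (diag_complete L1).
Proof.
move=> cL1 y1 s t A s0 st FA; have FXA := fst_filtration FA.
have mA := natural_filtration_measurable mX1 FA.
have t0 := le_trans s0 st.
have intL := diag_complete_locally_integrable cL1.1.
rewrite (fst_forward _ s0 st FXA); congr (_ + _).
have sub : `[s, t] `<=` (`[0, t] : set R) by apply: subset_itv; rewrite bnd_simp.
apply: Rintegral_ae_eq => //.
- by apply: integrableS (pair_sum_integrable y1 t0 mA).
- apply: integrableS (forward_sum_integrable P fst_right_constant mX1 intL y1 t0 mA) => //.
(* The test [x1 != z1] goes under the almost-everywhere quantifier so that all pairs of states can
   be gathered into one null set. *)
have aeL x1 z1 : {ae lebesgue_measure, forall u : R, x1 != z1 -> 0 <= u ->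
    forall A, natural_filtration X1 u A ->
    \sum_x2 c u x1 x2 z1 * p A u x1 x2 = L1 u x1 z1 * p1 A u x1}.
  have [->|xz] := eqVneq x1 z1; first exact: aeW.
  by apply: ae_mono (consistency_prob cL1 xz) _ => u + _.
have {}aeL : {ae lebesgue_measure, forall u : R, forall x1 z1, x1 != z1 -> 0 <= u ->
    forall A, natural_filtration X1 u A ->
    \sum_x2 c u x1 x2 z1 * p A u x1 x2 = L1 u x1 z1 * p1 A u x1}.
  by do 2 (apply: ae_forall_fin => ?); exact: aeL.
apply: ae_mono aeL _ => u aeu; rewrite /= in_itv/= => /andP[su ut].
have u0 := le_trans s0 su.
have FuA := natural_filtration_le su FA.
apply: eq_bigr => x1 _; rewrite /diag_complete; case: ifPn => [/eqP ->|xy]; last exact: aeu.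
(* Diagonal term: rows of [Lam] sum to 0, so grouping targets by first coordinate gives the rate
   from [(y1, x2)] back to [y1] as minus the sum of the rates to the other [z], and these are known
   from [aeu]. *)
rewrite mulNr mulr_suml.
rewrite [X in - X](eq_bigr (fun z => \sum_x2 c u y1 x2 z * p A u y1 x2)); last first.
  by move=> z zy; rewrite aeu// eq_sym.
rewrite exchange_big/= -sumrN; apply: eq_bigr => x2 _.
rewrite -mulr_suml -mulNr; congr (_ * _); apply/eqP; rewrite -addr_eq0.
have [_ _ /(_ u (y1, x2) u0)] := genLam.
rewrite (eq_bigr (fun z => Lam u (y1, x2) (z.1, z.2))); last by case.
rewrite -(pair_bigA _ (fun a b => Lam u (y1, x2) (a, b)))/=.
by rewrite (bigD1 y1)//= => ->.
Qed.

(** * Necessity: rates as limits of short-time transition probabilities *)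

Local Notation right_diff f s := (n.+1%:R *
    \int[lebesgue_measure]_(u in `[s, s + n.+1%:R^-1]) f u @[n --> \oo] --> f s).

(* E(1_B 1_{X1_u = x} r), where r is the total rate from the current state of X
   to the states whose first coordinate is y. *)
Definition fst_flow x y B (u : R) : R := \sum_x2 c u x x2 y * p B u x x2.
(** A deterministic, locally integrable majorant, independent of the event: it controls the error in
    the difference quotients and bounds [fst_rate]. *)
Definition fst_rate_norm y (u : R) : R := \sum_x1 \sum_x2 `|c u x1 x2 y|.

Lemma pair_rate_locally_integrable x1 x2 y : Defs.locally_integrable (fun u => c u x1 x2 y).
Proof.
move=> t t0; apply: integrable_sumR => // y2 _.
exact: pair_locally_integrable.
Qed.

Lemma fst_rate_norm_locally_integrable y : Defs.locally_integrable (fst_rate_norm y).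
Proof.
move=> t t0; apply: integrable_sumR => // x1 _; apply: integrable_sumR => // x2 _.
by apply: integrable_norm; exact: pair_rate_locally_integrable.
Qed.

Lemma fst_flow_locally_integrable x y B : measurable B ->
  Defs.locally_integrable (fst_flow x y B).
Proof.
move=> mB t t0; apply: integrable_sumR => // x2 _.
apply: occupation_prob_integrable => //; last exact: pair_rate_locally_integrable.
- by move=> w u /andP[u0 _]; exact: pair_right_constant.
- by move=> u a _; exact: pair_measurable.
Qed.

(** The quotient is the average over [[s, s + 1/(n+1)]] of a flow on the event [B], [X1_s = x],
    which itself varies with [s]. Differentiation is therefore assumed for the flow of [B], with
    [X1_u = x] in place of [X1_s = x]; the difference is controlled by the mismatch probability
    times [fst_rate_norm]. *)
Lemma fst_quotient_cvg s x y B : 0 <= s -> x != y -> natural_filtration X1 s B ->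
  right_diff (fst_flow x y B) s -> right_diff (fst_rate_norm y) s ->
  n.+1%:R * p1 (B `&` X1 s @^-1` [set x]) (s + n.+1%:R^-1) y
    @[n --> \oo] --> fst_flow x y B s.
Proof.
move=> s0 xy FB DB Dl.
have mB := natural_filtration_measurable mX1 FB.
set A := B `&` _.
have FA : natural_filtration X1 s A.
  by apply: natural_filtrationI => //; apply: natural_filtrationP; rewrite s0/=.
have mA := natural_filtration_measurable mX1 FA.
have FXA : natural_filtration XX s A by exact: fst_filtration FA.
have h0 n : 0 < n.+1%:R^-1 :> R by rewrite invr_gt0.
pose q u := \sum_x1 \sum_x2 c u x1 x2 y * p A u x1 x2.
(* The initial term of the forward equation vanishes because [A] forces [X1_s = x], and [x != y]. *)
have aE n : n.+1%:R * p1 A (s + n.+1%:R^-1) y =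
    n.+1%:R * \int[lebesgue_measure]_(u in `[s, s + n.+1%:R^-1]) q u.
  rewrite (fst_forward _ s0 _ FXA) ?lerDl ?ltW//.
  rewrite (_ : A `&` _ = set0) ?measure0 ?add0r//.
  by rewrite -subset0 => w [[_ /= ->]] /eqP; rewrite (negbTE xy).
have intq t : 0 <= t -> lebesgue_measure.-integrable `[0, t] (EFin \o q).
  by move=> t0; exact: pair_sum_integrable.
have intB := fst_flow_locally_integrable x y mB.
have intl := fst_rate_norm_locally_integrable y.
have sub n : `[s, s + n.+1%:R^-1] `<=` (`[0, s + n.+1%:R^-1] : set R).
  by apply: subset_itv; rewrite bnd_simp.
have sh0 n : 0 <= s + n.+1%:R^-1 :> R by rewrite addr_ge0// ltW.
pose a n := n.+1%:R * \int[lebesgue_measure]_(u in `[s, s + n.+1%:R^-1]) q u.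
pose b n := n.+1%:R * \int[lebesgue_measure]_(u in `[s, s + n.+1%:R^-1]) fst_flow x y B u.
suff ab : (fun n => a n - b n) @ \oo --> (0 : R).
  have -> : (fun n => n.+1%:R * p1 A (s + n.+1%:R^-1) y) = (fun n => (a n - b n) + b n).
    by apply/funext => n; rewrite aE subrK.
  by rewrite -[X in _ --> X]add0r; apply: cvgD.
have l0 u : 0 <= fst_rate_norm y u by apply: sumr_ge0 => z _; apply: sumr_ge0.
apply/cvgrPdist_le => e e0.
(* The averages of [fst_rate_norm] tend to its value at [s], so [K] eventually bounds them; a
   mismatch probability of at most [e / K] then makes the error at most [e]. *)
pose K := fst_rate_norm y s + 1.
have K0 : 0 < K by rewrite ltr_wpDl.
have [|eta eta0 Heta] := mismatch_prob_small P fst_right_constant mX1 (e := e / K) s0.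
  by rewrite divr_gt0.
have bound u : s <= u < s + eta -> `|q u - fst_flow x y B u| <= fst_rate_norm y u * (e / K).
  move=> sue; have Hu := Heta u sue.
  have -> : q u - fst_flow x y B u = \sum_x1 \sum_x2 c u x1 x2 y *
      (p A u x1 x2 - (if x1 == x then p B u x1 x2 else 0)).
    under [RHS]eq_bigr => x1 _.
      under eq_bigr => x2 _ do rewrite mulrBr.
      rewrite sumrB; over.
    rewrite sumrB; congr (_ - _).
    rewrite [RHS](bigD1 x)//= [X in _ = _ + X]big1 ?addr0.
      by apply: eq_bigr => x2 _; rewrite eqxx.
    by move=> z /negbTE ->; rewrite big1// => x2 _; rewrite mulr0.
  rewrite /fst_rate_norm mulr_suml (le_trans (ler_norm_sum _ _ _))//; apply: ler_sum => x1 _.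
  rewrite mulr_suml (le_trans (ler_norm_sum _ _ _))//; apply: ler_sum => x2 _.
  rewrite normrM ler_wpM2l// (le_trans _ Hu)//.
  have mm := mismatch_measurable mX1 u s.
  have mXX x1' x2' := pair_measurable u (x1', x2').
  case: eqVneq => [->|x1x].
    apply: fine_prob_dist_le => //; [exact: measurableI|exact: measurableI|..].
      move=> w [Bw XXw]; have [X1s|X1s] := eqVneq (X1 s w) x; first by left.
      right => /= us; move: XXw => /=; rewrite /pair_process => -[X1u _].
      by rewrite -us X1u eqxx in X1s.
    by move=> w [[Bw _] XXw]; left.
  have -> : 0 = fine (P set0) by rewrite measure0.
  apply: fine_prob_dist_le => //; first exact: measurableI.
  move=> w [[_ /= X1s]]; rewrite /pair_process => -[X1u _]; right => /= us.
  by rewrite -X1u us X1s eqxx in x1x.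
have nK : \forall n \near \oo, n.+1%:R * \int[lebesgue_measure]_(u in `[s, s + n.+1%:R^-1])
    fst_rate_norm y u <= K.
  have /cvgrPdist_le/(_ 1 ltr01) := Dl; apply: filterS => n.
  by rewrite ler_distlC => /andP[_].
have nh : \forall n \near \oo, n.+1%:R^-1 < eta.
  have /cvgrPdist_lt/(_ _ eta0) := @cvg_harmonic R; apply: filterS => n.
  by rewrite sub0r normrN (gtr0_norm (h0 n)).
have intqB n : lebesgue_measure.-integrable `[s, s + n.+1%:R^-1]
    (EFin \o (fun u => q u - fst_flow x y B u)).
  have : lebesgue_measure.-integrable `[s, s + n.+1%:R^-1]
      ((EFin \o q) \- (EFin \o fst_flow x y B))%E.
    apply: integrableB => //; first by apply: integrableS (intq _ (sh0 n)).
    by apply: integrableS (intB _ (sh0 n)).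
  by apply: eq_integrable => // u _ /=; rewrite EFinB.
near=> n.
have nKn : n.+1%:R * \int[lebesgue_measure]_(u in `[s, s + n.+1%:R^-1])
    fst_rate_norm y u <= K by near: n.
have nhn : n.+1%:R^-1 < eta by near: n.
rewrite sub0r normrN /a /b -mulrBr -RintegralB//; last 2 first.
- by apply: integrableS (intq _ (sh0 n)).
- by apply: integrableS (intB _ (sh0 n)).
rewrite normrM ger0_norm//.
apply: (@le_trans _ _ (n.+1%:R * \int[lebesgue_measure]_(u in `[s, s + n.+1%:R^-1])
    (fst_rate_norm y u * (e / K)))).
  rewrite ler_wpM2l//; apply: le_trans; first exact: le_normr_Rintegral.
  apply: le_Rintegral => //.
  - exact: integrable_norm.
  - have : lebesgue_measure.-integrable `[s, s + n.+1%:R^-1]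
        (EFin \o (fun u => e / K * fst_rate_norm y u)).
      by apply: integrableZlR => //; apply: integrableS (intl _ (sh0 n)).
    by apply: eq_integrable => // u _ /=; rewrite mulrC.
  move=> u; rewrite /= in_itv/= => /andP[su ush]; apply: bound.
  by rewrite su (le_lt_trans ush)// ltrD2l.
rewrite RintegralZr//; last by apply: integrableS (intl _ (sh0 n)).
rewrite mulrA; apply: le_trans (ler_wpM2r _ nKn) _; first by rewrite divr_ge0// ltW.
by rewrite mulrC divfK// gt_eqF.
Unshelve. all: by end_near.
Qed.

Hypothesis markovX1 : markov_wrt P (natural_filtration X1) X1.

Lemma markov_flow_at s x y B : 0 <= s -> x != y -> natural_filtration X1 s B ->
  right_diff (fst_flow x y B) s -> right_diff (fst_flow x y setT) s ->
  right_diff (fst_rate_norm y) s ->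
  p1 setT s x * fst_flow x y B s = p1 B s x * fst_flow x y setT s.
Proof.
move=> s0 xy FB DB DT Dl.
have mB := natural_filtration_measurable mX1 FB.
have FT : natural_filtration X1 s setT by exact: natural_filtrationT.
have cB := fst_quotient_cvg s0 xy FB DB Dl.
have cT := fst_quotient_cvg s0 xy FT DT Dl.
have h0 n : 0 < n.+1%:R^-1 :> R by rewrite invr_gt0.
have [_ mk] := markovX1.
(* By the Markov property both quotients contain the same factor [g x], with [g] depending on [n].
   Cross-multiplying removes it without dividing by a probability that may be 0. *)
have key n : p1 setT s x * (n.+1%:R * p1 (B `&` X1 s @^-1` [set x]) (s + n.+1%:R^-1) y) =
             p1 B s x * (n.+1%:R * p1 (setT `&` X1 s @^-1` [set x]) (s + n.+1%:R^-1) y).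
  have [|g [_ _ Hg]] := mk s (s + n.+1%:R^-1) s0 _ y; first by rewrite lerDl ltW.
  have gE A : natural_filtration X1 s A ->
      p1 (A `&` X1 s @^-1` [set x]) (s + n.+1%:R^-1) y = g x * p1 A s x.
    move=> FA; have FAx : natural_filtration X1 s (A `&` X1 s @^-1` [set x]).
      by apply: natural_filtrationI => //; apply: natural_filtrationP; rewrite s0/=.
    have mAx := natural_filtration_measurable mX1 FAx.
    have := Hg _ FAx; rewrite (fun_of_state_integral P mX1 g s mAx) integral_indic//.
    move=> /(congr1 fine)/= E.
    rewrite setIC -E.
    rewrite (bigD1 x)//= -setIA setIid big1 ?addr0// => z zx.
    rewrite (_ : _ `&` _ = set0) ?measure0 ?mulr0//.
    by rewrite -subset0 => w [[_ /= ->]] /eqP; rewrite eq_sym (negbTE zx).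
  by rewrite !gE//; ring.
have limZ (k l : R) (f : nat -> R) : f @ \oo --> l -> (fun n => k * f n) @ \oo --> k * l.
  by move=> fl; apply: cvgM => //; exact: cvg_cst.
have l1 := limZ (p1 setT s x) _ _ cB.
have l2 := limZ (p1 B s x) _ _ cT.
rewrite -(cvg_lim (@Rhausdorff R) l1) -(cvg_lim (@Rhausdorff R) l2).
by congr (lim (_ @ \oo)); apply/funext => n; exact: key.
Qed.

Lemma markov_flow x y : x != y ->
  {ae lebesgue_measure, forall s : R, 0 <= s -> forall A, natural_filtration X1 s A ->
    p1 setT s x * fst_flow x y A s = p1 A s x * fst_flow x y setT s}.
Proof.
move=> xy.
(* The cylinders are not yet restricted to times before [s]: a countable family independent of [s]
   yields a single null set. *)
have ae1 : {ae lebesgue_measure, forall s : R, forall l, 0 <= s ->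
    right_diff (fst_flow x y (rat_cylinder X1 l)) s}.
  apply: ae_forall_count => l.
  apply: right_lebesgue_differentiation; apply: fst_flow_locally_integrable => //.
  exact: rat_cylinder_measurable.
have ae2 : {ae lebesgue_measure, forall s : R, 0 <= s -> right_diff (fst_rate_norm y) s}.
  by apply: right_lebesgue_differentiation; exact: fst_rate_norm_locally_integrable.
have cylT : rat_cylinder X1 [::] = setT by apply/seteqP; split.
apply: ae_mono (ae_and ae1 ae2) _ => s [Dc Dl] s0 A FA.
(* The integral of [g] over an event is the difference of the two sides of the claim, which is thus
   put in the form that the pi-lambda argument handles. *)
pose g z : R := if z.1 == x then p1 setT s x * c s x z.2 y - fst_flow x y setT s else 0.
have gE B : measurable B -> (\int[P]_(w in B) (g (XX s w))%:E)%E =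
    (p1 setT s x * fst_flow x y B s - p1 B s x * fst_flow x y setT s)%:E.
  move=> mB; rewrite fun_of_state_integral//; last exact: pair_measurable.
  rewrite (eq_bigr (fun z => (g (z.1, z.2) * p B s z.1 z.2)%R)); last by case.
  rewrite -(pair_bigA _ (fun a b => (g (a, b) * p B s a b)%R))/=.
  rewrite (bigD1 x)//= [X in (_ + X)%R]big1 ?addr0; last first.
    by move=> z zx; rewrite big1// => x2 _; rewrite /g/= (negbTE zx) mul0r.
  rewrite (prob_fst_sum s x mB) [fst_flow x y B s]/fst_flow mulr_sumr mulr_suml -sumrB; congr _%:E.
  by apply: eq_bigr => x2 _; rewrite /g/= eqxx; ring.
have mA := natural_filtration_measurable mX1 FA.
suff : (\int[P]_(w in A) (g (XX s w))%:E = 0)%E.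
  by rewrite gE// => -[] /eqP; rewrite subr_eq0 => /eqP.
apply: (integral_pi_system_eq0 (G := rat_pi_system X1 s)).
- exact: rat_pi_systemI.
- exact: rat_pi_systemT.
- move=> _ [l [m [_ ->]]]; apply: measurableI; first exact: rat_cylinder_measurable.
  by apply: (natural_filtration_measurable mX1 (t := s)); exact: state_cylinder_adapted.
- by apply: fun_of_state_integrable; exact: pair_measurable.
- move=> _ [l [m [ls ->]]].
  have mB := rat_cylinder_measurable mX1 l.
  have mC : measurable (state_cylinder X1 s m).
    by apply: (natural_filtration_measurable mX1 (t := s)); exact: state_cylinder_adapted.
  have [mx|mx] := boolP (all (eq_op x) m); last first.
    apply: integral0_eq => w [_ sw]; rewrite /g/=; case: eqP => // X1x.
    by exfalso; move/negP: mx; apply; move: sw; rewrite /state_cylinder/= X1x.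
  have sx : X1 s @^-1` [set x] `<=` state_cylinder X1 s m.
    by move=> w /= X1x; rewrite /state_cylinder /= X1x.
  rewrite gE//; last exact: measurableI.
  have sI C : C `<=` X1 s @^-1` [set x] ->
      rat_cylinder X1 l `&` state_cylinder X1 s m `&` C = rat_cylinder X1 l `&` C.
    by move=> Cx; rewrite -setIA; congr (_ `&` _); apply/setIidPr => w /Cx/sx.
  rewrite sI// [X in (p1 setT s x * X - _)%R](_ : _ = fst_flow x y (rat_cylinder X1 l) s).
    rewrite markov_flow_at ?subrr//; first exact: rat_cylinder_adapted.
      exact: Dc.
    by rewrite -cylT; exact: Dc.
    exact: Dl.
  apply: eq_bigr => x2 _; rewrite sI//; rewrite pair_preimage; exact: subIsetl.
- by apply: natural_filtration_rat => //; exact: fst_right_constant.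
Qed.

(* Equal to 0 at times with P(X1_u = x) = 0, because x / 0 = 0. *)
Definition fst_rate u x y : R := fst_flow x y setT u / p1 setT u x.

Lemma le_fst_prob A u x1 x2 : measurable A -> p A u x1 x2 <= p1 A u x1.
Proof.
move=> mA; rewrite (prob_fst_sum u x1 mA) (bigD1 x2)//= lerDl.
by apply: sumr_ge0 => z _; rewrite fine_ge0.
Qed.

(** As a weighted sum with weights [P(X_u = (x, x2)) / P(X1_u = x)], each at most 1, it is dominated
    by [fst_rate_norm]. *)
Lemma fst_rate_locally_integrable x y :
  Defs.locally_integrable (fun u => fst_rate u x y).
Proof.
move=> t t0; have intf := fst_flow_locally_integrable x y measurableT t0.
have intl := fst_rate_norm_locally_integrable y t0.
apply: le_integrable intl => //.
  apply/measurable_EFinP; apply: measurable_funM.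
    by apply/measurable_EFinP; exact: measurable_int intf.
  apply: measurable_inv_ge0 => [u|]; first exact: fine_ge0.
  (* With constant rate 1, the occupation lemma yields measurability of [P(X1_u = x)] in [u]. *)
  have int1 : lebesgue_measure.-integrable `[0, t] (EFin \o cst (1 : R)).
    apply: measurable_bounded_integrable => //.
      by rewrite /= lebesgue_measure_itv/=; case: ifP; rewrite ?ltry.
    exists 1; split => // M M1 u _ /=; rewrite normr1; exact: ltW.
  have rct w t' : 0 <= t' < t -> exists2 e, 0 < e & forall u, t' <= u < t' + e -> X1 u w = X1 t' w.
    by move=> /andP[t'0 _]; exact: fst_right_constant.
  have := occupation_prob_integrable P rct (fun u a _ => mX1 u a) int1 x measurableT.
  move=> /measurable_int/measurable_EFinP.
  by apply: eq_measurable_fun => u _; rewrite /= mul1r.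
move=> u _; rewrite lee_fin [leRHS]ger0_norm; last first.
  by apply: sumr_ge0 => z _; exact: sumr_ge0.
rewrite /fst_rate /fst_flow mulr_suml (le_trans (ler_norm_sum _ _ _))//.
rewrite /fst_rate_norm (bigD1 x)//= ler_wpDr//.
  by apply: sumr_ge0 => z _; exact: sumr_ge0.
apply: ler_sum => x2 _; rewrite -mulrA normrM ler_piMr//.
have p0 := fine_ge0 (measure_ge0 P (setT `&` XX u @^-1` [set (x, x2)])).
have p10 := fine_ge0 (measure_ge0 P (setT `&` X1 u @^-1` [set x])).
rewrite ger0_norm ?divr_ge0//.
have [->|p1n0] := eqVneq (p1 setT u x) 0; first by rewrite invr0 mulr0.
by rewrite ler_pdivrMr ?mul1r ?le_fst_prob// lt_neqAle eq_sym p1n0.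
Qed.

(** Division by [P(X1_s = x)]; if that is 0, every term of the flow is the probability of a null
    event times a rate, and both sides vanish. *)
Lemma flow_fst_rate s x y A : measurable A ->
  p1 setT s x * fst_flow x y A s = p1 A s x * fst_flow x y setT s ->
  fst_flow x y A s = fst_rate s x y * p1 A s x.
Proof.
move=> mA E; have [p0|p0] := eqVneq (p1 setT s x) 0; last first.
  by apply: (mulfI p0); rewrite E /fst_rate; field.
have pA0 B : measurable B -> p1 B s x = 0.
  move=> mB; apply/le_anti; rewrite fine_ge0// andbT -p0.
  rewrite fine_le ?fin_num_measure//; try exact: measurableI.
  rewrite le_measure ?inE//; try exact: measurableI.
  exact: setSI.
rewrite pA0// mulr0 /fst_flow big1// => x2 _.
suff -> : p A s x x2 = 0 by rewrite mulr0.
by apply/le_anti; rewrite fine_ge0// andbT -(pA0 A mA) le_fst_prob.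
Qed.

Lemma markov_consistency : consistency_condition P X1 X2 Lam fst_rate.
Proof.
split; first by move=> x y _; exact: fst_rate_locally_integrable.
move=> x y xy Y HY.
apply: ae_mono (markov_flow xy) _ => s H s0.
pose G := [set A | exists u a, 0 <= u <= s /\ A = X1 u @^-1` [set a]].
have mG : G `<=` measurable by exact: natural_generators_measurable.
have mYs x2 : measurable_fun setT (Y s x2 : g_sigma_algebraType G -> R).
  by move=> _ B mB; rewrite setTI; have [+ _ _] := HY s x2 s0; exact.
have iYs x2 : P.-integrable setT (EFin \o Y s x2) by have [] := HY s x2 s0.
have FX : natural_filtration X1 s (X1 s @^-1` [set x]).
  by apply: natural_filtrationP; rewrite s0/=.
have mX : measurable_fun setT (\1_(X1 s @^-1` [set x]) : g_sigma_algebraType G -> R).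
  exact: measurable_indic.
have sumE w : \sum_x2 \sum_y2 Lam s (x, x2) (y, y2) * Y s x2 w = \sum_x2 c s x x2 y * Y s x2 w.
  by apply: eq_bigr => x2 _; rewrite mulr_suml.
have indicM (h : T -> R) : (fun w => \1_(X1 s @^-1` [set x]) w * h w) = h \_ (X1 s @^-1` [set x]).
  by apply/funext => w; rewrite patchE indicE; case: (w \in _); rewrite ?mul1r ?mul0r.
have int_restrict (h : T -> R) : P.-integrable setT (EFin \o h) ->
    P.-integrable setT (EFin \o (fun w => \1_(X1 s @^-1` [set x]) w * h w)).
  move=> ih; rewrite indicM -restrict_EFin -integrable_mkcond//; exact: integrableS ih.
have isum : P.-integrable setT (EFin \o (fun w => \sum_x2 c s x x2 y * Y s x2 w)).
  by apply: integrable_sumR => // x2 _; exact: integrableZlR.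
suff ae : {ae P, forall w, \1_(X1 s @^-1` [set x]) w * (\sum_x2 c s x x2 y * Y s x2 w) =
    \1_(X1 s @^-1` [set x]) w * fst_rate s x y}.
  by apply: ae_mono ae _ => w; rewrite sumE.
(* Both sides are measurable for the past of [X1], so it is enough to compare integrals over its
   events [A]; on the left the versions [Y] turn into indicators and produce [fst_flow x y A s]. *)
apply: (sub_ae_eq (G := G)) => //.
- apply: measurable_funM => //; apply: measurable_sum => x2.
  by apply: measurable_funM => //; exact: measurable_cst.
- by apply: measurable_funM => //; exact: measurable_cst.
- exact: int_restrict.
- apply: int_restrict; exact: (finite_measure_integrable_cst P).
move=> A FA; have mA := natural_filtration_measurable mX1 FA.
have FAx := natural_filtrationI FA FX.
have mAx := natural_filtration_measurable mX1 FAx.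
have intE (h : T -> R) : (\int[P]_(w in A) (\1_(X1 s @^-1` [set x]) w * h w)%:E =
    \int[P]_(w in A `&` X1 s @^-1` [set x]) (h w)%:E)%E.
  rewrite integral_mkcondr; apply: eq_integral => w _.
  by rewrite -[X in X%:E]/((fun w => \1_(X1 s @^-1` [set x]) w * h w) w) indicM restrict_EFin.
rewrite !intE integral_cst//.
under eq_integral => w _ do rewrite -sumEFin.
rewrite integral_sum//; last by move=> x2; apply: integrableZlR => //; exact: integrableS (iYs x2).
rewrite (_ : (_ * _)%E = (fst_flow x y A s)%:E); last first.
  by rewrite (flow_fst_rate mA (H s0 A FA)) [RHS]EFinM fineK// fin_num_measure.
rewrite /fst_flow -sumEFin; apply: eq_bigr => x2 _.
under eq_integral => w _ do rewrite EFinM.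
rewrite integralZl//; last by apply: integrableS (iYs x2).
have [_ _ /(_ _ FAx) ->] := HY s x2 s0.
rewrite integral_indic// EFinM fineK; last first.
  by rewrite fin_num_measure//; apply: measurableI => //; exact: pair_measurable.
by rewrite setIC pair_preimage setIA.
Qed.

End pair.

Unset Implicit Arguments.

Theorem theorem1p1 (d : measure_display) (Omega : measurableType d)
  (R : realType) (P : probability Omega R) (S1 S2 : finType)
  (X1 : R -> Omega -> S1) (X2 : R -> Omega -> S2)
  (Lam : R -> S1 * S2 -> S1 * S2 -> R) :
  (forall t a, measurable (X1 t @^-1` [set a])) ->
  (forall t a, measurable (X2 t @^-1` [set a])) ->
  (forall w, cadlag_fin (fun t => pair_process X1 X2 t w)) ->
  is_generator_fun Lam ->
  markov_chain_with_generator P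
    (natural_filtration (pair_process X1 X2)) (pair_process X1 X2) Lam ->
  (markov_wrt P (natural_filtration X1) X1 <->
     exists L1 : R -> S1 -> S1 -> R, consistency_condition P X1 X2 Lam L1)
  /\
  (forall L1 : R -> S1 -> S1 -> R, consistency_condition P X1 X2 Lam L1 ->
     markov_chain_with_generator P (natural_filtration X1) X1
       (diag_complete L1)).
Proof.
move=> mX1 mX2 cadX genLam [_ genX].
have fwdX : forward_equation P (natural_filtration (pair_process X1 X2)) (pair_process X1 X2) Lam.
  apply: has_generator_forward genX.
  - exact: pair_right_constant.
  - exact: pair_measurable.
  - exact: pair_locally_integrable.
  - by move=> t A _; apply: natural_filtration_measurable; exact: pair_measurable.
(* This gives both the converse implication and the form of the generator. *)
have suff_cond L1 : consistency_condition P X1 X2 Lam L1 ->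
    markov_chain_with_generator P (natural_filtration X1) X1 (diag_complete L1).
  move=> cL1; have fwd1 := consistency_forward mX1 mX2 cadX genLam fwdX cL1.
  have intL1 := diag_complete_locally_integrable cL1.1.
  split; [apply: forward_markov fwd1|apply: forward_has_generator fwd1] => //;
    exact: fst_right_constant cadX.
split=> //; split=> [markovX1|[L1 /suff_cond[]]//].
exists (fst_rate P X1 X2 Lam); exact: markov_consistency.
Qed.
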